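(* Let $\mathcal H$ be a Hilbert space and let $$\mathcal C_0=\{(P,Q)\in\mathcal P(\mathcal H)\times\mathcal P(\mathcal H): r(P)<\infty \text{ or } r(Q)<\infty\}.$$ Then the connected components of $\mathcal C_0$ are the sets $$\mathcal C_{k,l}^{m,n}=\{(P,Q)\in\mathcal P(\mathcal H)\times\mathcal P(\mathcal H): r(P)=k,\ n(P)=l,\ r(Q)=m,\ n(Q)=n\},$$ with $\min\{k,l,m,n\}$ finite.
   Context: $\mathcal P(\mathcal H)$ denotes the set of orthogonal (selfadjoint) projections in the algebra $\mathcal B(\mathcal H)$ of bounded linear operators on $\mathcal H$. For a bounded operator $T$, $r(T)=\dim R(T)$ is its rank (dimension of the range) and $n(T)=\dim N(T)$ its nullity (dimension of the nullspace); the values $k,l,m,n$ may be infinite. $\mathcal C_0$ carries the topology induced by the operator norm of $\mathcal B(\mathcal H)\times\mathcal B(\mathcal H)$.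
   Formalization: Only nonempty sets C_{k,l}^{m,n} contained in C_0 are listed: as stated, k, m infinite and l finite (e.g. P=Q=I, dim H infinite) gives min{k,l,m,n} finite but a set outside C_0. Ranks and nullities are Hilbert dimensions (cardinals); H is complex. *)

(* Defs.v *)
From HB Require Import structures.
From mathcomp Require Import all_boot all_order all_algebra.
From mathcomp Require Import complex.
From mathcomp Require Import all_classical all_reals all_analysis.

Set Implicit Arguments.
Unset Strict Implicit.
Unset Printing Implicit Defensive.

Import Order.TTheory GRing.Theory Num.Theory.
Import numFieldNormedType.Exports.

Local Open Scope classical_set_scope.
Local Open Scope ring_scope.
Local Open Scope complex_scope.
Local Open Scope card_scope.

(* Complex Hilbert spaces: the inner product is linear in its first argument
   and conjugate-linear in the second one. *)
HB.mixin Record CompleteNormedModule_isHilbert (R : realType) H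
    & CompleteNormedModule R[i] H := {
  inner : {dot H for @conjc R} ;
  norm_inner : forall x : H, `|x| ^+ 2 = inner x x
}.

#[short(type="hilbertType")]
HB.structure Definition Hilbert (R : realType) :=
  {H of CompleteNormedModule R[i] H & CompleteNormedModule_isHilbert R H}.

Section BoundedOperators.
Context (R : realType) (H : hilbertType R).

Definition bounded_operator : {pred H -> H} := fun f =>
  `[< linear f /\ exists M : R, forall x, `|f x| <= M%:C * `|x| >].

Record bop := BOp { bop_fun :> H -> H ; _ : bop_fun \in bounded_operator }.

HB.instance Definition _ := [isSub for bop_fun].
HB.instance Definition _ := [Choice of bop by <:].

Lemma bopP (f : bop) :
  linear f /\ exists M : R, forall x, `|f x| <= M%:C * `|x|.
Proof. by case: f => f /= /asboolP. Qed.

Lemma bounded_operator_submod : submod_closed bounded_operator.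
Proof.
split=> [|a f g /asboolP[lf [M fM]] /asboolP[lg [N gN]]]; apply/asboolP.
  split=> [a x y|]; first by rewrite /= scaler0 addr0.
  by exists 0 => x; rewrite normr0 mul0r.
split=> [b x y|].
  rewrite /= !fctE lf lg !scalerDr !scalerA (mulrC b) -!addrA; congr (_ + _).
  by rewrite addrCA.
exists (complex.Re `|a| * M + N) => x; rewrite fctE (le_trans (ler_normD _ _))//.
rewrite rmorphD rmorphM/= (RRe_real (normr_real a)) mulrDl lerD ?gN//.
by rewrite normrZ -mulrA ler_wpM2l.
Qed.

HB.instance Definition _ :=
  GRing.isSubmodClosed.Build _ _ bounded_operator bounded_operator_submod.
HB.instance Definition _ := [SubChoice_isSubLmodule of bop by <:].

Implicit Types f g : bop.

Definition op_bounds (f : bop) : set R :=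
  [set M | 0 <= M /\ forall x, `|f x| <= M%:C * `|x|].

Definition opnorm (f : bop) : R := inf (op_bounds f).

Lemma op_bounds_inf f : has_inf (op_bounds f).
Proof.
split; last by exists 0 => M [].
have [_ [M fM]] := bopP f; exists `|M|; split=> // x.
by rewrite (le_trans (fM x))// ler_wpM2r// lecR ler_norm.
Qed.

Lemma opnorm_ge0 f : 0 <= opnorm f.
Proof. by apply: lb_le_inf; [case: (op_bounds_inf f)|move=> M []]. Qed.

Lemma opnormP f x : `|f x| <= (opnorm f)%:C * `|x|.
Proof.
have [->|x0] := eqVneq x 0.
  have [lf _] := bopP f; have := lf (-1) 0 0.
  by rewrite scaler0 addr0 scaleN1r addNr => ->; rewrite !normr0 mulr0.
rewrite -ler_pdivrMr ?normr_gt0//.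
have r_real : `|f x| / `|x| \is Num.real by rewrite realM ?realV ?normr_real.
rewrite -(RRe_real r_real) lecR; apply: lb_le_inf.
  by case: (op_bounds_inf f).
move=> M [_ fM]; rewrite -lecR RRe_real// ler_pdivrMr ?normr_gt0//.
Qed.

Lemma opnorm_le f M : 0 <= M -> (forall x, `|f x| <= M%:C * `|x|) ->
  opnorm f <= M.
Proof.
by move=> M0 fM; apply: ge_inf; [case: (op_bounds_inf f)|split].
Qed.

Let norm (f : bop) : R[i] := (opnorm f)%:C.

Let ler_normD f g : norm (f + g) <= norm f + norm g.
Proof.
rewrite /norm -rmorphD lecR; apply: opnorm_le => [|x].
  by rewrite addr_ge0 ?opnorm_ge0.
by rewrite rmorphD/= mulrDl (le_trans (ler_normD _ _))// lerD ?opnormP.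
Qed.

Let normrZ_le (l : R[i]) f : norm (l *: f) <= `|l| * norm f.
Proof.
rewrite /norm -(RRe_real (normr_real l)) -rmorphM/= lecR; apply: opnorm_le.
  by rewrite mulr_ge0 ?opnorm_ge0// -lecR (RRe_real (normr_real l)) normr_ge0.
by move=> x; rewrite rmorphM/= (RRe_real (normr_real l)) normrZ -mulrA ler_wpM2l ?opnormP.
Qed.

Let normr0_eq0 f : norm f = 0 -> f = 0.
Proof.
case=> f0; apply/val_inj/funext => x /=.
by apply/eqP; rewrite -normr_le0 (le_trans (opnormP _ _))// f0 mul0r.
Qed.

Let normrZ (l : R[i]) f : norm (l *: f) = `|l| * norm f.
Proof.
have [->|l0] := eqVneq l 0.
  rewrite normr0 mul0r scale0r /norm; suff -> : opnorm 0 = 0 by [].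
  apply/eqP; rewrite eq_le opnorm_ge0 andbT.
  by apply: opnorm_le => // x; rewrite normr0 mul0r.
apply/eqP; rewrite eq_le normrZ_le/= -ler_pdivlMl ?normr_gt0//.
by rewrite -normfV -{1}(scale1r f) -(mulVf l0) -scalerA normrZ_le.
Qed.

HB.instance Definition _ :=
  Lmodule_isNormed.Build R[i] bop ler_normD normrZ normr0_eq0.

End BoundedOperators.

Section Dimension.
Context (R : realType) (H : hilbertType R).
Implicit Types (A E : set H).

Definition orthonormal_set E := forall x y, E x -> E y ->
  inner x y = (x == y)%:R :> R[i].

Definition linear_span E : set H :=
  [set x | exists n (c : 'I_n -> R[i]) (e : 'I_n -> H),
     (forall i, E (e i)) /\ x = \sum_(i < n) c i *: e i].

Definition orthonormal_basis A E :=
  orthonormal_set E /\ closure (linear_span E) = A.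

(* The dimension of a closed subspace is its Hilbert dimension, the cardinality
   of an orthonormal basis: "dim A is the cardinality of the type k". *)
Definition hdim A (k : Type) :=
  exists2 E, orthonormal_basis A E & E #= [set: k].

Definition finite_hdim A := exists n, hdim A 'I_n.

End Dimension.

Section ProjectionPairs.
Context (R : realType) (H : hilbertType R).
Implicit Types (P Q T : bop H) (k l m n : Type).

Definition selfadjoint T := forall x y : H, inner (T x) y = inner x (T y).

Definition projections : set (bop H) :=
  [set P : bop H | (forall x, P (P x) = P x) /\ selfadjoint P].

Definition nullspace T : set H := T @^-1` [set 0].

Definition has_rank T k := hdim (range T) k.

Definition has_nullity T k := hdim (nullspace T) k.

Definition finite_rank T := finite_hdim (range T).

Definition proj_pairs : set (bop H * bop H) :=
  projections `*` projections.

Definition C0 : set (bop H * bop H) :=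
  proj_pairs `&` [set PQ | finite_rank PQ.1 \/ finite_rank PQ.2].

Definition Cklmn k l m n : set (bop H * bop H) :=
  proj_pairs `&` [set PQ | [/\ has_rank PQ.1 k, has_nullity PQ.1 l,
                               has_rank PQ.2 m & has_nullity PQ.2 n]].

End ProjectionPairs.

Arguments C0 {R} H.
Arguments Cklmn {R} H k l m n.

Definition connected_components (T : topologicalType) (A : set T) :
  set (set T) := connected_component A @` A.

(* For cardinals, min{k,l,m,n} is finite iff one of them is. *)
Definition min_finite (k l m n : Type) :=
  [\/ finite_set [set: k], finite_set [set: l], finite_set [set: m]
    | finite_set [set: n]].

(* Main.v *)
Require Import Defs.
From HB Require Import structures.
From mathcomp Require Import all_boot all_order all_algebra.
From mathcomp Require Import complex.
From mathcomp Require Import all_classical all_reals all_analysis.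
From mathcomp Require Import ring lra.

(* A product of connected sets being connected, it suffices to treat one projection at a time.

   Rank and nullity are locally constant: if |P - Q| <= 1/2 then UP = QU for the unitary U in
   the polar decomposition of (1 + (2Q - 1)(2P - 1)) / 2. Hence each component lies in one of
   the sets C_{k,l}^{m,n}.

   Conversely, projections with the same rank and nullity are conjugate under a unitary U,
   obtained by matching orthonormal bases. Any unitary is a product V1 V2 of two unitaries
   with nonnegative real part (V1 = iS and V2 = -iSU, where S is the sign of Im U), and such a
   unitary V is joined to 1 by the norm continuous path (r + V) (1 + rV)^-1 of unitaries,
   0 <= r <= 1. Square roots and inverses of operators come from norm convergent iterations,
   so no spectral theorem is needed. *)

(** The path (r + V) (1 + rV)^-1 is undefined at r = 1 when -1 lies in the spectrum of V, as for V =
    -1, so it cannot join an arbitrary unitary to 1 in one stroke. If Re V >= 0, then Re (1 + rV) >=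
    1, so the inverse exists with norm at most 1 for every r and the path is Lipschitz with a
    constant that does not depend on V. A square root of U would also split U into two such factors,
    but it calls for a branch of the root on the spectrum. The sign of Im U is cheaper: it comes
    from |Im U|, the square root of 1 - (Re U)^2, and from the orthogonal projection onto one
    nullspace, and it commutes with U. *)

Set Implicit Arguments.
Unset Strict Implicit.
Unset Printing Implicit Defensive.

Import Order.TTheory GRing.Theory Num.Theory.
Import numFieldNormedType.Exports.

Local Open Scope classical_set_scope.
Local Open Scope ring_scope.
Local Open Scope complex_scope.

(** * Norms and inner products over the reals *)

Section RealNorm.
Context (R : realType) (V : normedModType R[i]).
Implicit Types x y z : V.

Definition rnorm x : R := complex.Re `|x|.

Lemma normE x : `|x| = (rnorm x)%:C.
Proof. by rewrite /rnorm RRe_real// normr_real. Qed.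

Lemma rnorm_ge0 x : 0 <= rnorm x.
Proof. by rewrite -lecR -normE normr_ge0. Qed.

Lemma rnorm0 : rnorm 0 = 0.
Proof. by apply: complexI; rewrite -normE normr0. Qed.

Lemma rnorm0_eq0 x : rnorm x = 0 -> x = 0.
Proof. by move=> x0; apply/normr0_eq0; rewrite normE x0. Qed.

Lemma rnormN x : rnorm (- x) = rnorm x.
Proof. by rewrite /rnorm normrN. Qed.

Lemma rnormD x y : rnorm (x + y) <= rnorm x + rnorm y.
Proof. by rewrite -lecR rmorphD/= -!normE ler_normD. Qed.

Lemma rnormBC x y : rnorm (x - y) = rnorm (y - x).
Proof. by rewrite -rnormN opprB. Qed.

Lemma rnorm_triangle y x z : rnorm (x - z) <= rnorm (x - y) + rnorm (y - z).
Proof. by apply: le_trans (rnormD _ _); rewrite addrA subrK. Qed.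

Lemma rnormZ (a : R[i]) x : rnorm (a *: x) = complex.Re `|a| * rnorm x.
Proof.
by apply: complexI; rewrite -normE normrZ normE rmorphM/= RRe_real.
Qed.

Lemma rnormZr (t : R) x : rnorm (t%:C *: x) = `|t| * rnorm x.
Proof.
by rewrite rnormZ normc_def/= expr0n/= addr0 sqrtr_sqr.
Qed.

Lemma cvg_rnorm (u : nat -> V) x :
  (forall e, 0 < e -> exists N, forall n, (N <= n)%N -> rnorm (x - u n) <= e) ->
  u @ \oo --> x.
Proof.
move=> ux; apply/cvgrPdist_le => e; rewrite ltcE => /andP[/= /eqP e0 egt0].
have [N uN] := ux _ egt0; near=> n.
rewrite lecE normE/= e0 eqxx/=; apply: uN; near: n.
exact: nbhs_infty_ge.
Unshelve. all: by end_near. Qed.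

Lemma closure_rnormP (A : set V) x :
  closure A x <-> forall e : R, 0 < e -> exists2 y, A y & rnorm (x - y) < e.
Proof.
split=> [Ax e e0|Ax B /nbhs_ballP[e /=]].
  have /Ax[y [Ay]] : nbhs x (ball x e%:C) by apply: nbhsx_ballx; rewrite ltcR.
  by rewrite -ball_normE/= normE ltcR; exists y.
rewrite ltcE => /andP[/= /eqP e0 egt0] eB.
have [y Ay xy] := Ax _ egt0; exists y; split=> //; apply: eB.
by rewrite -ball_normE/= ltcE normE/= e0 eqxx.
Qed.

End RealNorm.

Section Completeness.
Context (R : realType) (V : completeNormedModType R[i]).

(** The Cauchy rate [b] is kept explicit so that the limit inherits it as an error bound. *)
Lemma rnorm_complete (u : nat -> V) (b : nat -> R) :
  (forall n m, (n <= m)%N -> rnorm (u n - u m) <= b n) ->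
  (forall e, 0 < e -> exists N, forall n, (N <= n)%N -> b n <= e) ->
  exists x, forall n, rnorm (x - u n) <= b n.
Proof.
move=> ub b0.
have : cauchy (u @ \oo).
  apply/cauchy_ballP => e; rewrite ltcE => /andP[/= /eqP e0 egt0].
  have [N bN] := b0 _ (divr_gt0 egt0 (ltr0Sn R 2)).
  have uN n : (N <= n)%N -> rnorm (u N - u n) < complex.Re e / 2.
    by move=> Nn; apply: le_lt_trans (ub _ _ Nn) (le_lt_trans (bN _ (leqnn _)) _); lra.
  exists ([set u n | n in [set n | (N <= n)%N]],
          [set u n | n in [set n | (N <= n)%N]]) => /=.
    by split; exists N => // n /= Nn; exists n.
  move=> [_ _] /= [[n /= Nn <-] [m /= Nm <-]].
  rewrite -ball_normE/= ltcE normE/= e0 eqxx/=.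
  apply: le_lt_trans (rnorm_triangle (u N) _ _) _.
  rewrite rnormBC; have := uN _ Nn; have := uN _ Nm; lra.
move=> /cauchy_cvgP/cvg_ex[/= x ux]; exists x => n.
apply/ler_addgt0Pr => e e0.
have : \forall m \near \oo, `|x - u m| <= e%:C.
  by move: ux => /cvgrPdist_le; apply; rewrite ltcR.
move=> [N _ uN].
have := uN (maxn N n) (leq_maxl _ _); rewrite /= normE lecR => xN.
apply: le_trans (rnorm_triangle (u (maxn N n)) _ _) _.
rewrite addrC lerD// rnormBC; exact/ub/leq_maxr.
Qed.

End Completeness.

Section RealInner.
Context (R : realType) (H : hilbertType R).
Implicit Types x y z : H.

(* The real part of the inner product determines it (innerE), so adjointness and
   orthogonality to complex subspaces can be tested on rdot alone. *)
Definition rdot x y : R := complex.Re (inner x y).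

Lemma innerC x y : inner x y = (inner y x)^*.
Proof. by rewrite hermitian_subproof expr0 mul1r. Qed.

Lemma rdotC x y : rdot x y = rdot y x.
Proof. by rewrite /rdot innerC; case: (inner y x). Qed.

Lemma rdotDl x y z : rdot (x + y) z = rdot x z + rdot y z.
Proof. by rewrite /rdot linearDl raddfD. Qed.

Lemma rdotNl x y : rdot (- x) y = - rdot x y.
Proof. by rewrite /rdot linearNl raddfN. Qed.

Lemma rdotZl (t : R) x y : rdot (t%:C *: x) y = t * rdot x y.
Proof. by rewrite /rdot linearZl_LR/=; case: (inner x y) => a b /=; simpc. Qed.

Lemma rdotDr x y z : rdot z (x + y) = rdot z x + rdot z y.
Proof. by rewrite !(rdotC z) rdotDl. Qed.

Lemma rdotNr x y : rdot y (- x) = - rdot y x.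
Proof. by rewrite !(rdotC y) rdotNl. Qed.

Lemma rdotZr (t : R) x y : rdot y (t%:C *: x) = t * rdot y x.
Proof. by rewrite !(rdotC y) rdotZl. Qed.

Lemma rdotBl x y z : rdot (x - y) z = rdot x z - rdot y z.
Proof. by rewrite rdotDl rdotNl. Qed.

Lemma rdotBr x y z : rdot z (x - y) = rdot z x - rdot z y.
Proof. by rewrite rdotDr rdotNr. Qed.

Lemma rdot0l x : rdot 0 x = 0.
Proof. by rewrite -(subrr x) rdotBl subrr. Qed.

Lemma rdotxx x : rdot x x = rnorm x ^+ 2.
Proof. by rewrite /rdot -norm_inner normE -rmorphXn. Qed.

Lemma innerE x y : inner x y = rdot x y +i* rdot x ('i *: y).
Proof.
rewrite /rdot linearZr_LR/=; case: (inner x y) => a b /=; congr (_ +i* _).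
by rewrite mul0r mulN1r opprK add0r.
Qed.

Lemma rdot_ii x y : rdot ('i *: x) ('i *: y) = rdot x y.
Proof.
by rewrite /rdot linearZr_LR linearZl_LR/= mulrA/=; simpc; case: (inner x y) => a b /=; simpc.
Qed.

Lemma rdot_i x y : rdot ('i *: x) y = - rdot x ('i *: y).
Proof.
by rewrite -[in RHS](rdot_ii x) scalerA -expr2 sqr_i scaleN1r rdotNr opprK.
Qed.

Lemma rnormD_sqr x y :
  rnorm (x + y) ^+ 2 = rnorm x ^+ 2 + 2 * rdot x y + rnorm y ^+ 2.
Proof. by rewrite -!rdotxx rdotDl !rdotDr (rdotC y x); lra. Qed.

Lemma rnormB_sqr x y :
  rnorm (x - y) ^+ 2 = rnorm x ^+ 2 - 2 * rdot x y + rnorm y ^+ 2.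
Proof. by rewrite -!rdotxx rdotBl !rdotBr (rdotC y x); lra. Qed.

Lemma rdot_le x y : rdot x y <= rnorm x * rnorm y.
Proof.
have [y0|] := eqVneq (rnorm y) 0.
  by rewrite y0 (rnorm0_eq0 y0) rdotC rdot0l mulr0.
move=> y0; have {y0} y0 : 0 < rnorm y by rewrite lt_def y0 rnorm_ge0.
have := rnorm_ge0 x => x0.
(* The square expands to 2 |x| |y| (|x| |y| - rdot x y); the factor |x| |y| is divided out at the
   end, once x is known to be nonzero. *)
have := sqr_ge0 (rnorm ((rnorm y)%:C *: x - (rnorm x)%:C *: y)).
rewrite rnormB_sqr !rnormZr rdotZl rdotZr (ger0_norm x0) (ger0_norm (ltW y0)) => h.
have [->|x1] := eqVneq x 0; first by rewrite rdot0l rnorm0 mul0r.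
have {}x1 : 0 < rnorm x.
  by rewrite lt_def x0 andbT; apply: contra_neq x1; exact: rnorm0_eq0.
have xy : 0 < rnorm x * rnorm y by rewrite mulr_gt0.
by rewrite -(ler_pM2l xy); lra.
Qed.

Lemma rdot_abs_le x y : `|rdot x y| <= rnorm x * rnorm y.
Proof.
by rewrite ler_norml rdot_le andbT lerNl -rdotNl -(rnormN x) rdot_le.
Qed.

Lemma rdot_eq0 x : (forall y, rdot x y = 0) -> x = 0.
Proof.
move=> x0; apply: rnorm0_eq0; apply/eqP.
by rewrite -sqrf_eq0 -rdotxx x0.
Qed.

Lemma rdot_inj x x' : (forall y, rdot x y = rdot x' y) -> x = x'.
Proof.
by move=> xx; apply/eqP; rewrite -subr_eq0; apply/eqP/rdot_eq0 => y; rewrite rdotBl xx subrr.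
Qed.

End RealInner.

(** * The algebra of bounded operators *)

Section OperatorAlgebra.
Context (R : realType) (H : hilbertType R).
Implicit Types (f g h : bop H) (x y : H).

Lemma bop_linear f : linear f. Proof. by have [] := bopP f. Qed.

Lemma bopD f x y : f (x + y) = f x + f y.
Proof. by have := bop_linear f 1 x y; rewrite !scale1r. Qed.

Lemma bop0 f : f 0 = 0.
Proof. by apply: (addrI (f 0)); rewrite -bopD !addr0. Qed.

Lemma bopZ f a x : f (a *: x) = a *: f x.
Proof. by have := bop_linear f a x 0; rewrite bop0 !addr0. Qed.

Lemma bopN f x : f (- x) = - f x.
Proof. by rewrite -scaleN1r bopZ scaleN1r. Qed.

Lemma bopB f x y : f (x - y) = f x - f y.
Proof. by rewrite bopD bopN. Qed.

Lemma bop_ext f g : (forall x, f x = g x) -> f = g.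
Proof. by move=> fg; apply/val_inj/funext. Qed.

Lemma bounded_operatorP (f : H -> H) : linear f ->
  (exists M : R, forall x, rnorm (f x) <= M * rnorm x) -> f \in @bounded_operator R H.
Proof.
move=> lf [M fM]; apply/asboolP; split=> //; exists M => x.
by rewrite !normE -rmorphM/= lecR.
Qed.

Lemma rnorm_bop f : rnorm f = opnorm f. Proof. by []. Qed.

Lemma rnorm_le_opnorm f x : rnorm (f x) <= opnorm f * rnorm x.
Proof. by rewrite -lecR rmorphM/= -!normE opnormP. Qed.

Lemma opnorm_leP f M : 0 <= M -> (forall x, rnorm (f x) <= M * rnorm x) ->
  opnorm f <= M.
Proof.
by move=> M0 fM; apply: opnorm_le => // x; rewrite !normE -rmorphM/= lecR.
Qed.

Fact id_bounded : (@id H) \in @bounded_operator R H.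
Proof. by apply: bounded_operatorP => //; exists 1 => x; rewrite mul1r. Qed.

Fact comp_bounded f g : f \o g \in @bounded_operator R H.
Proof.
apply: bounded_operatorP => [a x y /=|]; first by rewrite !bop_linear.
exists (opnorm f * opnorm g) => x /=.
apply: le_trans (rnorm_le_opnorm f (g x)) _.
by rewrite -mulrA ler_wpM2l ?opnorm_ge0 ?rnorm_le_opnorm.
Qed.

Definition bop1 : bop H := BOp id_bounded.
Definition bop_mul f g : bop H := BOp (comp_bounded f g).

Fact bop_mulA : associative bop_mul. Proof. by move=> f g h; apply: bop_ext. Qed.
Fact bop_mul1l : left_id bop1 bop_mul. Proof. by move=> f; apply: bop_ext. Qed.
Fact bop_mul1r : right_id bop1 bop_mul. Proof. by move=> f; apply: bop_ext. Qed.
Fact bop_mulDl : left_distributive bop_mul +%R.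
Proof. by move=> f g h; apply: bop_ext. Qed.
Fact bop_mulDr : right_distributive bop_mul +%R.
Proof. by move=> f g h; apply: bop_ext => x; exact: bopD. Qed.

(** H may be the zero space, hence a ring in which 1 = 0 is allowed; for the same reason [opnorm1]
    is only an inequality. *)
HB.instance Definition _ := GRing.Zmodule_isPzRing.Build (bop H)
  bop_mulA bop_mul1l bop_mul1r bop_mulDl bop_mulDr.

Lemma bop_mulE f g x : (f * g) x = f (g x). Proof. by []. Qed.
Lemma bop_addE f g x : (f + g) x = f x + g x. Proof. by []. Qed.
Lemma bop_oppE f x : (- f) x = - f x. Proof. by []. Qed.
Lemma bop_scaleE a f x : (a *: f) x = a *: f x. Proof. by []. Qed.
Lemma bop_1E x : (1 : bop H) x = x. Proof. by []. Qed.
Lemma bop_0E x : (0 : bop H) x = 0. Proof. by []. Qed.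

Definition bopE :=
  (bop_mulE, bop_addE, bop_oppE, bop_scaleE, bop_1E, bop_0E).

Lemma bop_scaleAl a f g : a *: (f * g) = (a *: f) * g.
Proof. exact: bop_ext. Qed.

Lemma bop_scaleAr a f g : a *: (f * g) = f * (a *: g).
Proof. by apply: bop_ext => x; rewrite !bopE bopZ. Qed.

Lemma opnormM f g : opnorm (f * g) <= opnorm f * opnorm g.
Proof.
apply: opnorm_leP => [|x]; first by rewrite mulr_ge0 ?opnorm_ge0.
apply: le_trans (rnorm_le_opnorm f (g x)) _.
by rewrite -mulrA ler_wpM2l ?opnorm_ge0 ?rnorm_le_opnorm.
Qed.

Lemma opnormD f g : opnorm (f + g) <= opnorm f + opnorm g.
Proof. by rewrite -!rnorm_bop rnormD. Qed.

Lemma opnormZr (t : R) f : opnorm (t%:C *: f) = `|t| * opnorm f.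
Proof. by rewrite -!rnorm_bop rnormZr. Qed.

Lemma opnorm1 : opnorm (1 : bop H) <= 1.
Proof. by apply: opnorm_leP => // x; rewrite mul1r. Qed.

Lemma opnorm_mul_le f g a b :
  opnorm f <= a -> opnorm g <= b -> opnorm (f * g) <= a * b.
Proof.
move=> fa gb; apply: le_trans (opnormM _ _) _.
by rewrite ler_pM ?opnorm_ge0.
Qed.

Lemma cvg_bopM (T T' : nat -> bop H) f g :
  T @ \oo --> f -> T' @ \oo --> g -> (fun n => T n * T' n) @ \oo --> f * g.
Proof.
move=> /cvgrPdist_le Tf /cvgrPdist_le T'g.
(* [C] collects the coefficients of the three error terms d |g|, |f| d and d^2 of the product; d <=
   1 makes the last one linear. *)
pose C := opnorm f + opnorm g + 1.
have C1 : 1 <= C by rewrite lerDr addr_ge0 ?opnorm_ge0.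
apply: cvg_rnorm => e e0.
pose d := Num.min 1 (e / C).
have d0 : 0 < d by rewrite lt_min ltr01 divr_gt0// (lt_le_trans _ C1).
have [N _ TN] : \forall n \near \oo, `|f - T n| <= d%:C by apply: Tf; rewrite ltcR.
have [N' _ TN'] : \forall n \near \oo, `|g - T' n| <= d%:C by apply: T'g; rewrite ltcR.
exists (maxn N N') => n; rewrite geq_max => /andP[/TN + /TN'].
rewrite /= !normE !lecR => Tn T'n.
have -> : f * g - T n * T' n =
    (f - T n) * g + f * (g - T' n) - (f - T n) * (g - T' n).
  rewrite [in RHS]addrAC -[in RHS]mulrBr subKr [in RHS]mulrBl [in RHS]mulrBr.
  by rewrite [in RHS]addrC addrA subrK.
apply: le_trans (rnormD _ _) _; rewrite rnormN.
apply: le_trans (lerD (rnormD _ _) (lexx _)) _; rewrite !rnorm_bop.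
have h1 := opnorm_mul_le Tn (lexx (opnorm g)).
have h2 := opnorm_mul_le (lexx (opnorm f)) T'n.
have h3 := opnorm_mul_le Tn T'n.
have d1 : d <= 1 by rewrite ge_min lexx.
have : d * C <= e by rewrite -ler_pdivlMr ?ge_min ?lexx ?orbT// (lt_le_trans _ C1).
have : d * d <= d by rewrite ler_piMl// ltW.
rewrite /C; lra.
Qed.

Lemma opnorm_cvg_le (T : nat -> bop H) f M :
  T @ \oo --> f -> (forall n, opnorm (T n) <= M) -> opnorm f <= M.
Proof.
move=> /cvgrPdist_le Tf TM; apply/ler_addgt0Pr => e e0.
have [N _ /(_ N (leqnn _))] : \forall n \near \oo, `|f - T n| <= e%:C.
  by apply: Tf; rewrite ltcR.
rewrite /= normE lecR rnorm_bop => h.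
rewrite -(subrK (T N) f) (le_trans (opnormD _ _))// addrC lerD//.
Qed.

Lemma cvg_comm (T : nat -> bop H) f h :
  T @ \oo --> f -> (forall n, GRing.comm h (T n)) -> GRing.comm h f.
Proof.
move=> Tf hT; apply: (@cvg_unique _ (@norm_hausdorff _ (bop H)) ((fun n => h * T n) @ \oo)).
  by apply: cvg_bopM => //; exact: cvg_cst.
have -> : (fun n => h * T n) = (fun n => T n * h) by apply/funext => n; exact: hT.
by apply: cvg_bopM => //; exact: cvg_cst.
Qed.

(** Serves as completeness of [bop H]. The increments telescope against those of [a], which is
    thereby monotone, and bounded by [M]; so sup a - a n bounds the distance from [T n] to the
    limit. *)
Lemma bop_cvg (T : nat -> bop H) (a : nat -> R) M :
  (forall n, opnorm (T n.+1 - T n) <= a n.+1 - a n) -> (forall n, a n <= M) ->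
  exists f, T @ \oo --> f.
Proof.
move=> Ta aM.
have Tnm n m : (n <= m)%N -> opnorm (T n - T m) <= a m - a n.
  move=> /subnKC <-; elim: (m - n)%N => [|k ih].
    by rewrite addn0 !subrr -rnorm_bop rnorm0.
  rewrite addnS -!rnorm_bop; apply: le_trans (rnorm_triangle (T (n + k)%N) _ _) _.
  by rewrite [X in _ + X]rnormBC; have := Ta (n + k)%N; rewrite !rnorm_bop; lra.
have amono n m : (n <= m)%N -> a n <= a m.
  by move=> /Tnm h; rewrite -subr_ge0 (le_trans _ h)// opnorm_ge0.
have asup : has_sup (range a).
  by split; [exists (a 0%N); exists 0%N|exists M => _ [n _ <-]].
pose b n := sup (range a) - a n.
have ab n m : a m - a n <= b n.
  by rewrite /b lerB//; apply: sup_ubound; [case: asup|exists m].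
have b0 n : 0 <= b n by apply: le_trans (ab n n); rewrite subrr.
have bsmall e : 0 < e -> exists N, forall n, (N <= n)%N -> b n <= e.
  move=> e0; have [_ [N _ <-] h] := sup_adherent e0 asup.
  by exists N => n /amono; rewrite /b; lra.
have /choice[S ST] x : exists y, forall n, rnorm (y - T n x) <= b n * rnorm x.
  apply: (@rnorm_complete _ _ (fun n => T n x) (fun n => b n * rnorm x)) => [n m nm|e e0].
    apply: le_trans (rnorm_le_opnorm (T n - T m) x) _.
    by rewrite ler_wpM2r ?rnorm_ge0// (le_trans (Tnm _ _ nm)).
  have x0 : 0 < rnorm x + 1 by rewrite ltr_wpDl ?rnorm_ge0.
  have [N bN] := bsmall _ (divr_gt0 e0 x0); exists N => n /bN.
  rewrite ler_pdivlMr// => h; apply: le_trans h.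
  by rewrite ler_wpM2l// lerDl.
have Slin : linear S.
  move=> c x y; apply/eqP; rewrite -subr_eq0; apply/eqP/rnorm0_eq0/eqP.
  rewrite eq_le rnorm_ge0 andbT.
  pose K := rnorm (c *: x + y) + complex.Re `|c| * rnorm x + rnorm y.
  have c0 : 0 <= complex.Re `|c| by have := normr_ge0 c; rewrite lecE/= => /andP[].
  have K0 : 0 <= K by rewrite /K !addr_ge0 ?mulr_ge0 ?rnorm_ge0.
  (* [T n] is linear, so the defect of linearity of [S] is a combination of errors [S - T n], and
     this for every n. *)
  have hK n : rnorm (S (c *: x + y) - (c *: S x + S y)) <= b n * K.
    have -> : S (c *: x + y) - (c *: S x + S y) =
        (S (c *: x + y) - T n (c *: x + y)) - (c *: (S x - T n x) + (S y - T n y)).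
      rewrite bop_linear scalerBr [in RHS](addrACA (c *: S x)) -[- _ - T n y]opprD.
      by rewrite [in RHS]opprB [in RHS]addrA subrK.
    apply: le_trans (rnormD _ _) _; rewrite rnormN.
    apply: le_trans (lerD (lexx _) (rnormD _ _)) _; rewrite rnormZ.
    have := ST (c *: x + y) n; have := ST y n.
    have := ler_wpM2l c0 (ST x n); rewrite /K; lra.
  apply/ler_addgt0Pr => e e0; rewrite add0r.
  have K1 : 0 < K + 1 by rewrite ltr_wpDl.
  have [N /(_ N (leqnn _))] := bsmall _ (divr_gt0 e0 K1).
  rewrite ler_pdivlMr// => h; apply: le_trans (hK N) (le_trans _ h).
  by rewrite ler_wpM2l// lerDl.
have Sbd : S \in @bounded_operator R H.
  apply: bounded_operatorP => //; exists (b 0%N + opnorm (T 0%N)) => x.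
  rewrite -(subrK (T 0%N x) (S x)) (le_trans (rnormD _ _))// mulrDl lerD//.
  exact: rnorm_le_opnorm.
exists (BOp Sbd); apply: cvg_rnorm => e /bsmall[N bN]; exists N => n Nn.
rewrite rnorm_bop; apply: le_trans (bN _ Nn); apply: opnorm_leP => // x.
exact: ST.
Qed.

End OperatorAlgebra.

Section Adjoint.
Context (R : realType) (H : hilbertType R).
Implicit Types (f g h : bop H) (x y : H).

Definition adjoint f g := forall x y, rdot (f x) y = rdot x (g y).

Lemma adjointC f g : adjoint f g -> adjoint g f.
Proof. by move=> fg x y; rewrite rdotC -fg rdotC. Qed.

Lemma adjoint1 : adjoint (1 : bop H) 1. Proof. by []. Qed.

Lemma adjoint0 : adjoint (0 : bop H) 0.
Proof. by move=> x y; rewrite !bop_0E rdot0l rdotC rdot0l. Qed.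

Lemma adjointD f g f' g' : adjoint f g -> adjoint f' g' -> adjoint (f + f') (g + g').
Proof. by move=> fg fg' x y; rewrite !bopE rdotDl rdotDr fg fg'. Qed.

Lemma adjointN f g : adjoint f g -> adjoint (- f) (- g).
Proof. by move=> fg x y; rewrite !bopE rdotNl rdotNr fg. Qed.

Lemma adjointB f g f' g' : adjoint f g -> adjoint f' g' -> adjoint (f - f') (g - g').
Proof. by move=> fg fg'; apply: adjointD => //; exact: adjointN. Qed.

Lemma adjointM f g f' g' : adjoint f g -> adjoint f' g' -> adjoint (f * f') (g' * g).
Proof. by move=> fg fg' x y; rewrite !bopE fg fg'. Qed.

Lemma adjointZr (t : R) f g : adjoint f g -> adjoint (t%:C *: f) (t%:C *: g).
Proof. by move=> fg x y; rewrite !bopE rdotZl rdotZr fg. Qed.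

Lemma adjoint_i f g : adjoint f g -> adjoint ('i *: f) (- 'i *: g).
Proof. by move=> fg x y; rewrite !bopE scaleNr rdotNr rdot_i fg bopZ. Qed.

Lemma selfadjointP f : selfadjoint f <-> adjoint f f.
Proof.
split=> [sf x y|sf x y]; first by rewrite /rdot sf.
by rewrite !innerE !sf bopZ.
Qed.

Lemma cvg_adjoint (T : nat -> bop H) f :
  T @ \oo --> f -> (forall n, adjoint (T n) (T n)) -> adjoint f f.
Proof.
move=> /cvgrPdist_le Tf Ta x y; apply/eqP; rewrite -subr_eq0 -normr_le0.
apply/ler_addgt0Pr => e e0; rewrite add0r.
(* The defect of symmetry of [f] equals that of [f - T N], which is at most 2 |f - T N| K; the 1 in
   [K + 1] avoids a division by zero. *)
pose K := rnorm x * rnorm y.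
have K0 : 0 <= K by rewrite mulr_ge0 ?rnorm_ge0.
have K1 : 0 < 2 * (K + 1) by rewrite mulr_gt0// ltr_wpDl.
have [N _ /(_ N (leqnn _))] : \forall n \near \oo, `|f - T n| <= (e / (2 * (K + 1)))%:C.
  by apply: Tf; rewrite ltcR divr_gt0.
rewrite /= normE lecR rnorm_bop ler_pdivlMr// => h.
have -> : rdot (f x) y - rdot x (f y) =
    rdot ((f - T N) x) y - rdot x ((f - T N) y).
  by rewrite !bopE rdotBl rdotBr Ta; lra.
apply: le_trans (ler_normB _ _) _.
have h1 : `|rdot ((f - T N) x) y| <= opnorm (f - T N) * K.
  apply: le_trans (rdot_abs_le _ _) _; rewrite mulrA.
  by rewrite ler_wpM2r ?rnorm_ge0 ?rnorm_le_opnorm.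
have h2 : `|rdot x ((f - T N) y)| <= opnorm (f - T N) * K.
  apply: le_trans (rdot_abs_le _ _) _; rewrite mulrCA.
  by rewrite ler_wpM2l ?rnorm_ge0 ?rnorm_le_opnorm.
have := opnorm_ge0 (f - T N); lra.
Qed.

End Adjoint.

(** * Square roots and inverses *)

Section SquareRootInverse.
Context (R : realType) (H : hilbertType R).
Implicit Types (f g h : bop H) (x y : H).

Lemma commZr (a : R[i]) f g : GRing.comm f g -> GRing.comm f (a *: g).
Proof. by rewrite /GRing.comm => fg; rewrite -bop_scaleAr fg bop_scaleAl. Qed.

Lemma cvg_bop_shift (T : nat -> bop H) (F : bop H -> bop H) f :
  (forall n, T n.+1 = F (T n)) -> T @ \oo --> f -> (F \o T) @ \oo --> F f -> f = F f.
Proof.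
move=> TF Tf FTf; apply: (@cvg_unique _ (@norm_hausdorff _ (bop H)) ((F \o T) @ \oo)) => //.
have -> : F \o T = [sequence T n.+1]_n by apply/funext => n /=; rewrite TF.
by move: Tf; rewrite /= -cvg_shiftS.
Qed.

Section SquareRoot.
Context (X : bop H).
Hypotheses (Xadj : adjoint X X) (X1 : opnorm X <= 1).

(* The fixed point 1 - sqrt (1 - X) of this step is reached in norm: the increments of
   Y are dominated by those of the scalar sequence y, which is the case X = 1. *)
Let step f := (2^-1)%:C *: (X + f * f).
Let Y n := iter n step 0.
Let y n := iter n (fun t : R => 2^-1 * (1 + t * t)) 0.

Let y_bound n : 0 <= y n <= 1.
Proof.
elim: n => [|n /andP[y0 y1]]; first by rewrite /y/= lexx ler01.
rewrite -[y n.+1]/(2^-1 * (1 + y n * y n)); apply/andP; split; nra.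
Qed.

Let Y_bound n : opnorm (Y n) <= y n.
Proof.
elim: n => [|n ih]; first by rewrite /y/= -rnorm_bop rnorm0.
rewrite -[Y n.+1]/(step (Y n)) -[y n.+1]/(2^-1 * (1 + y n * y n)) opnormZr ger0_norm ?invr_ge0//.
rewrite ler_wpM2l ?invr_ge0//; apply: le_trans (opnormD _ _) _.
by rewrite lerD// opnorm_mul_le.
Qed.

Let Y_incr n : opnorm (Y n.+1 - Y n) <= y n.+1 - y n.
Proof.
elim: n => [|n ih]; first by rewrite !subr0; exact: Y_bound.
(* a^2 - b^2 = a (a - b) + (a - b) b holds without commutativity, and each product is dominated by
   its scalar counterpart. *)
have -> : Y n.+2 - Y n.+1 =
    (2^-1)%:C *: (Y n.+1 * (Y n.+1 - Y n) + (Y n.+1 - Y n) * Y n).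
  rewrite mulrBr mulrBl addrA subrK -[Y n.+2]/(step (Y n.+1)) [in - Y _]/Y/= -/(Y n).
  rewrite -scalerBr; congr (_ *: _).
  by rewrite opprD addrACA subrr add0r.
have -> : y n.+2 - y n.+1 = 2^-1 * (y n.+1 * (y n.+1 - y n) + (y n.+1 - y n) * y n).
  rewrite -[LHS]/(2^-1 * (1 + y n.+1 * y n.+1) - 2^-1 * (1 + y n * y n)).
  by rewrite mulrBr mulrBl addrA subrK; ring.
rewrite opnormZr ger0_norm ?invr_ge0// ler_wpM2l ?invr_ge0//.
by apply: le_trans (opnormD _ _) _; rewrite lerD// opnorm_mul_le// Y_bound.
Qed.

(** [B] is 1 - f for the limit f of [Y]: the fixed point equation 2f = X + f^2 gives (1 - f)^2 = 1 -
    X, and |f| <= 1 gives positivity. The iterates are polynomials in [X], so whatever commutes with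
    [X] commutes with f. *)
Lemma bop_sqrt : exists B : bop H, [/\ B * B = 1 - X, adjoint B B,
  forall x, 0 <= rdot (B x) x & forall Z, GRing.comm Z X -> GRing.comm Z B].
Proof.
have [f Yf] : exists f, Y @ \oo --> f.
  by apply: bop_cvg Y_incr _ => n; case/andP: (y_bound n) => _; exact.
have ff : f = step f.
  apply: (cvg_bop_shift (T := Y)) => //.
  by apply: cvgZr; apply: cvgD; [exact: cvg_cst|exact: cvg_bopM].
have f1 : opnorm f <= 1.
  apply: opnorm_cvg_le Yf _ => n; apply: le_trans (Y_bound n) _.
  by case/andP: (y_bound n).
have fadj : adjoint f f.
  apply: cvg_adjoint Yf _; elim=> [|n ih]; first exact: adjoint0.
  by apply: adjointZr; apply: adjointD => //; exact: adjointM.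
exists (1 - f); split.
- have f2 : f + f = X + f * f.
    rewrite {1 2}ff /step -scalerDl -rmorphD/=.
    have -> : 2^-1 + 2^-1 = 1 :> R by lra.
    by rewrite scale1r.
  have ffX : f - f * f = X - f by apply/eqP; rewrite subr_eq addrAC -f2 addrK.
  by rewrite mulrBl mul1r mulrBr mulr1 ffX opprB addrA subrK.
- by apply: adjointB.
- move=> x; rewrite bopE bopE bop_1E rdotBl rdotxx.
  have := rdot_le (f x) x; have := rnorm_le_opnorm f x.
  have := rnorm_ge0 x; have := rnorm_ge0 (f x); have := opnorm_ge0 f; nra.
- move=> Z ZX; apply: commrB; first exact: commr1.
  apply: cvg_comm Yf _; elim=> [|n ih]; first exact: commr0.
  by apply: commZr; apply: commrD => //; exact: commrM.
Qed.

End SquareRoot.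

(** A Neumann series: D / 4 = 1 - K with |K| < 1. Coercivity, rather than positivity of a
    selfadjoint operator, is assumed because [resolvent] applies this to 1 + rV. *)
Lemma coercive_inverse (D : bop H) :
  (forall x, rnorm x ^+ 2 <= rdot (D x) x) -> (forall x, rnorm (D x) <= 2 * rnorm x) ->
  exists E : bop H, [/\ D * E = 1, E * D = 1, opnorm E <= 1 &
    forall Z, GRing.comm Z D -> GRing.comm Z E].
Proof.
move=> Dge Dle.
(* The two bounds give |x - t D x|^2 <= (1 - 2t + 4t^2) |x|^2, which is least at t = 1/4, with value
   3/4 <= (7/8)^2. *)
pose K : bop H := 1 - (4^-1)%:C *: D.
have K78 : opnorm K <= 7 / 8.
  apply: opnorm_leP => [|x]; first by lra.
  rewrite -(@ler_pXn2r _ 2) ?nnegrE ?rnorm_ge0//; last by apply: mulr_ge0; [lra|exact: rnorm_ge0].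
  rewrite !bopE rnormB_sqr rnormZr rdotZr ger0_norm ?invr_ge0// (rdotC x) !exprMn.
  have : rnorm (D x) ^+ 2 <= 4 * rnorm x ^+ 2.
    by have := Dle x; have := rnorm_ge0 x; have := rnorm_ge0 (D x); nra.
  have := Dge x; have := sqr_ge0 (rnorm x); rewrite !expr2; lra.
pose step (f : bop H) : bop H := (4^-1)%:C *: (1 : bop H) + K * f.
pose T n : bop H := iter n step 0.
have TS n : T n.+1 = (4^-1)%:C *: (1 : bop H) + K * T n by [].
(* The partial sums of the geometric series with first term 1/4 and ratio 7/8. *)
pose a n : R := 2 * (1 - (7 / 8) ^+ n).
have a2 n : a n <= 2.
  have : 0 <= (7 / 8 : R) ^+ n by apply: exprn_ge0; lra.
  by rewrite /a; lra.
have Ta n : opnorm (T n.+1 - T n) <= a n.+1 - a n.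
  elim: n => [|n ih].
    rewrite /T /= /step mulr0 addr0 subr0 opnormZr ger0_norm ?invr_ge0// /a expr0 expr1.
    by have := opnorm1 H; lra.
  have -> : T n.+2 - T n.+1 = K * (T n.+1 - T n).
    by rewrite mulrBr (TS n.+1) [in - T n.+1]TS opprD addrACA subrr add0r.
  have := opnorm_mul_le K78 ih; rewrite /a !exprS; lra.
have [E TE] := bop_cvg Ta a2.
have EE : E = step E.
  apply: (cvg_bop_shift (T := T)) => //.
  by apply: cvgD; [exact: cvg_cst|apply: cvg_bopM => //; exact: cvg_cst].
have DE : D * E = 1.
  have : (4^-1)%:C *: (D * E) = (4^-1)%:C *: (1 : bop H).
    apply/eqP; rewrite bop_scaleAl -subr_eq0 -opprB oppr_eq0; apply/eqP.
    apply: (addIr E); rewrite add0r [in RHS]EE /step /K mulrBl mul1r.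
    by rewrite addrA addrAC.
  apply: scalerI; apply/eqP => -[]; apply/eqP; rewrite invr_eq0 pnatr_eq0//.
have commE Z : GRing.comm Z D -> GRing.comm Z E.
  move=> ZD; apply: cvg_comm TE _; elim=> [|n ih]; first exact: commr0.
  apply: commrD; first by apply: commZr; exact: commr1.
  by apply: commrM => //; apply: commrB; [exact: commr1|exact: commZr].
exists E; split=> //; first by rewrite -(commE D).
apply: opnorm_leP => // x; rewrite mul1r.
(* Coercivity at E x reads |E x|^2 <= rdot x (E x) <= |x| |E x|. *)
have := Dge (E x); rewrite -bop_mulE DE bop_1E.
have := rdot_le x (E x); have := rnorm_ge0 (E x); have := rnorm_ge0 x.
move=> x0 Ex0 h1 h2; rewrite leNgt; apply/negP => h; nra.
Qed.

End SquareRootInverse.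

(** * Closed subspaces, orthogonal projections and orthonormal bases *)

Section ClosedSubspaces.
Context (R : realType) (H : hilbertType R).
Implicit Types (f g h P T : bop H) (x y z : H) (A E L : set H).

Definition subspace L := L 0 /\ forall (a : R[i]) x y, L x -> L y -> L (a *: x + y).

Lemma subspaceD L x y : subspace L -> L x -> L y -> L (x + y).
Proof. by move=> [_ LD] Lx Ly; rewrite -(scale1r x); exact: LD. Qed.

Lemma subspaceZ L a x : subspace L -> L x -> L (a *: x).
Proof. by move=> [L0 LD] Lx; rewrite -(addr0 (_ *: _)); exact: LD. Qed.

Lemma subspaceB L x y : subspace L -> L x -> L y -> L (x - y).
Proof. by move=> sL Lx Ly; rewrite -scaleN1r; apply: subspaceD => //; exact: subspaceZ. Qed.

Lemma subspace_closure L : subspace L -> subspace (closure L).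
Proof.
move=> [L0 LD]; split; first exact: subset_closure.
move=> a x y /closure_rnormP Lx /closure_rnormP Ly; apply/closure_rnormP => e e0.
have a0 : 0 <= complex.Re `|a| by have := normr_ge0 a; rewrite lecE/= => /andP[].
have a1 : 0 < complex.Re `|a| + 1 by rewrite ltr_wpDl.
have [x' Lx' xx'] := Lx _ (divr_gt0 (divr_gt0 e0 (ltr0Sn R 1)) a1).
have [y' Ly' yy'] := Ly _ (divr_gt0 e0 (ltr0Sn R 1)).
exists (a *: x' + y'); first exact: LD.
rewrite opprD addrACA -scalerBr; apply: le_lt_trans (rnormD _ _) _.
rewrite rnormZ; move: xx'; rewrite ltr_pdivlMr// => xx'.
have := rnorm_ge0 (x - x'); lra.
Qed.

Lemma linear_span_subspace E : subspace (linear_span E).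
Proof.
split.
  by exists 0%N, (fun=> 0), (fun=> 0); split; [case|rewrite big_ord0].
move=> a x y [n [c [u [Eu ->]]]] [m [d [v [Ev ->]]]].
exists (n + m)%N, (fun i => match fintype.split i with inl j => a * c j | inr j => d j end),
  (fun i => match fintype.split i with inl j => u j | inr j => v j end); split.
  by move=> i; case: (fintype.split i).
rewrite big_split_ord/=; congr (_ + _).
  rewrite scaler_sumr; apply: eq_bigr => i _.
  by rewrite (unsplitK (inl i)) scalerA.
by apply: eq_bigr => i _; rewrite (unsplitK (inr i)).
Qed.

Lemma sub_linear_span E : E `<=` linear_span E.
Proof.
by move=> x Ex; exists 1%N, (fun=> 1), (fun=> x); rewrite big_ord1 scale1r.
Qed.

Lemma linear_span_min E L : subspace L -> E `<=` L -> linear_span E `<=` L.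
Proof.
move=> sL EL _ [n [c [u [Eu ->]]]].
apply: (big_ind L); [by case: sL|by move=> x y; exact: subspaceD|move=> i _].
by apply: subspaceZ => //; exact: EL.
Qed.

Lemma nullspace_subspace T : subspace (nullspace T).
Proof.
by split=> [|a x y]; rewrite /nullspace/= ?bop0// bop_linear => -> ->; rewrite scaler0 addr0.
Qed.

Lemma nullspace_closed T : closed (nullspace T).
Proof.
move=> x /closure_rnormP Tx; apply/rnorm0_eq0/eqP.
rewrite eq_le rnorm_ge0 andbT; apply/ler_addgt0Pr => e e0; rewrite add0r.
have T1 : 0 < opnorm T + 1 by rewrite ltr_wpDl ?opnorm_ge0.
have [y Ty] := Tx _ (divr_gt0 e0 T1); rewrite ltr_pdivlMr// => xy.
rewrite -(subr0 (T x)) -Ty -bopB; apply: le_trans (rnorm_le_opnorm _ _) _.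
by have := rnorm_ge0 (x - y); lra.
Qed.

Lemma nullspace_closure_span T E : (forall x, E x -> T x = 0) ->
  forall x, closure (linear_span E) x -> T x = 0.
Proof.
move=> ET x Ex; apply: (@nullspace_closed T).
by apply: closureS x Ex; apply: linear_span_min => //; exact: nullspace_subspace.
Qed.

(** This is how ranges of projections inherit closedness from nullspaces. *)
Lemma range_proj P : projections P -> range P = nullspace (1 - P).
Proof.
move=> [PP _]; have E y : (1 - P : bop H) y = y - P y by [].
apply/seteqP; split=> [_ [x _ <-]|x].
  by rewrite -[nullspace _ _]/(_ = _) E PP subrr.
rewrite -[nullspace _ _]/(_ = _) E => /eqP.
by rewrite subr_eq0 => /eqP Px; exists x.
Qed.

Lemma rdotZ a x y : rdot (a *: x) y = rdot x (a^* *: y).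
Proof. by rewrite /rdot linearZl_LR linearZr_LR/= conjcK. Qed.

Lemma inner_eq0 L x : subspace L -> (forall z, L z -> rdot x z = 0) ->
  forall z, L z -> inner x z = 0.
Proof.
move=> sL xL z Lz; rewrite innerE !xL//; exact: subspaceZ.
Qed.

Section Projection.
Context (L : set H).
Hypotheses (sL : subspace L) (cL : closed L).

Lemma nearest_point x : exists2 y, L y & forall z, L z -> rnorm (x - y) <= rnorm (x - z).
Proof.
pose S := [set rnorm (x - y) ^+ 2 | y in L].
pose d := inf S.
have S0 : has_inf S.
  split; first by exists (rnorm (x - 0) ^+ 2); exists 0 => //; case: sL.
  by exists 0 => _ [y _ <-]; exact: sqr_ge0.
have dle z : L z -> d <= rnorm (x - z) ^+ 2.
  by move=> Lz; apply: inf_lbound; [case: S0|exists z].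
have d0 : 0 <= d.
  by apply: lb_le_inf; [case: S0|move=> _ [y _ <-]; exact: sqr_ge0].
pose r n : R := n.+1%:R^-1.
have r0 n : 0 < r n by rewrite invr_gt0 ltr0Sn.
have rmono n m : (n <= m)%N -> r m <= r n.
  by move=> nm; rewrite lef_pV2 ?posrE ?ltr0Sn// ler_nat ltnS.
(* The excess over [d] is a square because the parallelogram law then gives |u n - u m|^2 <= 2 (r
   n)^2 + 2 (r m)^2 <= (2 r n)^2. *)
have /choice[u uP] n : exists y, L y /\ rnorm (x - y) ^+ 2 <= d + r n ^+ 2.
  have [_ [y Ly <-] yd] := inf_adherent (exprn_gt0 2 (r0 n)) S0.
  by exists y; split=> //; exact: ltW.
have uu n m : (n <= m)%N -> rnorm (u n - u m) <= 2 * r n.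
  move=> nm; have [Ln dn] := uP n; have [Lm dm] := uP m.
  rewrite -(@ler_pXn2r _ 2) ?nnegrE ?rnorm_ge0//; last first.
    by rewrite mulr_ge0// ltW.
  have Lnm : L ((2^-1)%:C *: (u n + u m)) by apply: subspaceZ => //; exact: subspaceD.
  have := dle _ Lnm.
  have e1 : (x - u n) + (x - u m) = 2%:C *: (x - (2^-1)%:C *: (u n + u m)).
    rewrite scalerBr scalerA -rmorphM/= divff ?pnatr_eq0// scale1r opprD addrACA.
    by rewrite rmorph_nat scaler_nat mulr2n.
  have e2 : u n - u m = (x - u m) - (x - u n).
    by rewrite opprB [RHS]addrC addrA subrK.
  have := rnormD_sqr (x - u n) (x - u m); rewrite e1 rnormZr.
  have := rnormB_sqr (x - u m) (x - u n); rewrite -e2 (rdotC (x - u m)).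
  have := rmono _ _ nm; have := r0 m; have := r0 n.
  rewrite ger0_norm// !exprMn => h1 h2 h3 -> h4 h5.
  have : r m ^+ 2 <= r n ^+ 2 by rewrite !expr2; nra.
  lra.
have rsmall (e : R) : 0 < e -> exists N, forall n, (N <= n)%N -> 2 * r n <= e.
  move=> e0; have e20 : 0 < e / 2 by rewrite divr_gt0.
  have [N /= _ hN] := near_infty_natSinv_lt (PosNum e20).
  exists N => n /hN rn; have {rn} : r n < e / 2 := rn.
  by move: (r n) => t; lra.
have [y yu] := rnorm_complete uu rsmall.
exists y.
  apply: cL; apply/closure_rnormP => e e0.
  have e20 : 0 < e / 2 by rewrite divr_gt0.
  have [N /(_ N (leqnn _)) hN] := rsmall _ e20; exists (u N); first by case: (uP N).
  by apply: le_lt_trans (yu N) (le_lt_trans hN _); lra.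
move=> z Lz; apply/ler_addgt0Pr => e e0.
have e20 : 0 < e / 2 by rewrite divr_gt0.
have [N /(_ N (leqnn _)) hN] := rsmall _ e20.
have xuN : rnorm (x - u N) <= rnorm (x - z) + r N.
  have xz0 := rnorm_ge0 (x - z); have := r0 N => rN0.
  rewrite -(@ler_pXn2r _ 2) ?nnegrE ?rnorm_ge0//; last by lra.
  have [_] := uP N; have := dle _ Lz; nra.
have := yu N; rewrite rnormBC => yuN.
have := rnorm_triangle (u N) x y; lra.
Qed.

Lemma orthogonal_decomposition x : exists y, L y /\ forall z, L z -> rdot (x - y) z = 0.
Proof.
have [y Ly ymin] := nearest_point x; exists y; split=> // z Lz.
have [z0|z0] := eqVneq (rnorm z) 0.
  by rewrite (rnorm0_eq0 z0) rdotC rdot0l.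
have {z0} z0 : 0 < rnorm z by rewrite lt_def z0 rnorm_ge0.
(* The coefficient of x - y along z: moving y by t z lowers the squared distance by t^2 |z|^2, so
   minimality forces t = 0. *)
pose t := rdot (x - y) z / rnorm z ^+ 2.
have tz : t * rnorm z ^+ 2 = rdot (x - y) z by rewrite /t divfK// sqrf_eq0 gt_eqF.
have Lt : L (y + t%:C *: z) by apply: subspaceD => //; exact: subspaceZ.
have := ymin _ Lt; rewrite opprD addrA => h.
have : rnorm (x - y) ^+ 2 <= rnorm (x - y - t%:C *: z) ^+ 2.
  by rewrite ler_pXn2r ?nnegrE ?rnorm_ge0.
rewrite (rnormB_sqr (x - y)) rnormZr rdotZr exprMn real_normK ?num_real// -tz => h1.
have : t ^+ 2 * rnorm z ^+ 2 <= 0 by nra.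
rewrite -exprMn => h2.
have /eqP : (t * rnorm z) ^+ 2 = 0 by apply/eqP; rewrite eq_le h2 sqr_ge0.
by rewrite sqrf_eq0 expr2 mulrA => /eqP ->; rewrite mul0r.
Qed.

Theorem projection_onto : exists2 P, projections P & forall x, L x <-> P x = x.
Proof.
have /choice[p pP] := orthogonal_decomposition.
have Lp x : L (p x) by case: (pP x).
have op x z : L z -> rdot (x - p x) z = 0 by case: (pP x) => _; exact.
(* Both linearity and the fixed points of [p] follow from this uniqueness. *)
have puniq x y : L y -> (forall z, L z -> rdot (x - y) z = 0) -> p x = y.
  move=> Ly oy; apply/eqP; rewrite -subr_eq0; apply/eqP/rnorm0_eq0/eqP.
  have Lpy : L (p x - y) by exact: subspaceB.
  rewrite -sqrf_eq0 -rdotxx -{1}[p x](subKr x) addrAC rdotBl oy// op//.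
  by rewrite subr0.
have plin : linear p.
  move=> a x y; apply: puniq => [|z Lz]; first by case: sL => _; exact.
  rewrite opprD addrACA -scalerBr rdotDl rdotZ !op ?addr0//; exact: subspaceZ.
have op' x z : L z -> rdot (p x) z = rdot x z.
  by move=> Lz; apply/eqP; rewrite eq_sym -subr_eq0 -rdotBl op.
have pbd : p \in @bounded_operator R H.
  apply: bounded_operatorP => //; exists 1 => x; rewrite mul1r.
  have := op' x _ (Lp x); rewrite rdotxx => h.
  have := rdot_le x (p x); rewrite -h.
  have := rnorm_ge0 x; have := rnorm_ge0 (p x) => p0 x0 h1.
  by rewrite leNgt; apply/negP => h2; nra.
have pfix x : L x <-> p x = x.
  split=> [Lx|<-//]; apply: puniq => // z _; by rewrite subrr rdot0l.
exists (BOp pbd) => //; split=> [x|].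
  exact/pfix.
apply/selfadjointP => x y; rewrite /=.
by rewrite rdotC -(op' y _ (Lp x)) rdotC (op' x _ (Lp y)).
Qed.

End Projection.

(** A maximal orthonormal subset of [L] exists by Zorn. If its closed span missed some x in [L], the
    normalised component of x orthogonal to that span could be added. *)
Theorem orthonormal_basis_exists L : subspace L -> closed L ->
  exists E, orthonormal_basis L E.
Proof.
move=> sL cL.
pose ON := [set E | orthonormal_set E /\ E `<=` L].
have [E [[onE EL] Emax]] : exists E, ON E /\ forall B, E `<` B -> ~ ON B.
  apply: Zorn_bigcup => F FON Ftot; split=> [x y [X FX Xx] [Y FY Yy]|x [X FX Xx]].
    have [XY|YX] := Ftot _ _ FX FY.
      by case: (FON _ FY) => onY _; apply: onY => //; exact: XY.
    by case: (FON _ FX) => onX _; apply: onX => //; exact: YX.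
  by case: (FON _ FX) => _; exact.
exists E; split=> //.
have sE := subspace_closure (linear_span_subspace E).
have EcE x : E x -> closure (linear_span E) x.
  by move=> Ex; apply: subset_closure; exact: sub_linear_span.
have cEL : closure (linear_span E) `<=` L.
  by move=> x /(closureS (linear_span_min sL EL)); exact: cL.
apply/seteqP; split=> // x Lx.
have [P [PP Psa] Pfix] := projection_onto sE (@closed_closure _ _).
apply/Pfix; apply: contrapT => Px.
pose w := x - P x.
have Lw : L w by apply: subspaceB => //; apply: cEL; apply/Pfix.
have wE z : E z -> inner w z = 0.
  move=> /EcE; apply: (inner_eq0 sE) => u /Pfix <-; move/selfadjointP: Psa => Psa.
  by rewrite /w rdotBl -!Psa PP subrr.
have w0 : 0 < rnorm w.
  rewrite lt_def rnorm_ge0 andbT; apply/eqP => /rnorm0_eq0/eqP.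
  by rewrite subr_eq0 => /eqP /esym.
pose v := (rnorm w)^-1%:C *: w.
have vv : inner v v = 1.
  rewrite /v -norm_inner normE rnormZr ger0_norm ?invr_ge0 ?rnorm_ge0//.
  by rewrite mulVf ?expr1n// gt_eqF.
have vE z : E z -> inner v z = 0.
  by move=> Ez; rewrite /v linearZl_LR/= wE// mulr0.
have Ev : ~ E v by move=> /vE; rewrite vv => /eqP; rewrite oner_eq0.
have Lv : L v by exact: subspaceZ.
apply: (Emax (E `|` [set v])).
  by split=> [|h]; [exact: subsetUl|apply: Ev; apply: h; right].
split; last by move=> z [/EL//|->].
move=> y z [Ey|->] [Ez|->]; first exact: onE.
- rewrite innerC vE// conjc0; case: eqP => // yv; by rewrite yv in Ey.
- by rewrite vE//; case: eqP => // vz; rewrite -vz in Ez.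
- by rewrite vv eqxx.
Qed.

End ClosedSubspaces.

(** * Unitary equivalence of projections *)

Section Unitaries.
Context (R : realType) (H : hilbertType R).
Implicit Types (f g P Q U V : bop H) (x y z : H) (A E L : set H).

(* Carrying the adjoint of a unitary explicitly avoids the Riesz representation theorem. *)
Definition unitary_pair U U' := [/\ U * U' = 1, U' * U = 1 & adjoint U U'].

Lemma unitary_pairC U U' : unitary_pair U U' -> unitary_pair U' U.
Proof. by case=> UU' U'U UaU'; split=> //; exact: adjointC. Qed.

Lemma unitary_pairM U U' V V' :
  unitary_pair U U' -> unitary_pair V V' -> unitary_pair (U * V) (V' * U').
Proof.
move=> [UU' U'U aU] [VV' V'V aV]; split; last exact: adjointM.
  by rewrite mulrA -(mulrA U) VV' mulr1.
by rewrite mulrA -(mulrA V') U'U mulr1.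
Qed.

Section UnitaryPair.
Context (U U' : bop H) (Uu : unitary_pair U U').

Lemma unitaryK x : U' (U x) = x.
Proof. by case: Uu => _ U'U _; rewrite -bop_mulE U'U. Qed.

Lemma unitaryVK x : U (U' x) = x.
Proof. by case: Uu => UU' _ _; rewrite -bop_mulE UU'. Qed.

Lemma unitary_rdot x y : rdot (U x) (U y) = rdot x y.
Proof. by case: (Uu) => _ _ ->; rewrite unitaryK. Qed.

Lemma unitary_inner x y : inner (U x) (U y) = inner x y.
Proof. by rewrite !innerE -bopZ !unitary_rdot. Qed.

Lemma unitary_rnorm x : rnorm (U x) = rnorm x.
Proof.
apply/eqP; rewrite -(@eqrXn2 _ 2) ?rnorm_ge0//.
by rewrite -!rdotxx unitary_rdot.
Qed.

Lemma unitary_opnorm : opnorm U <= 1.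
Proof. by apply: opnorm_leP => // x; rewrite unitary_rnorm mul1r. Qed.

Lemma unitary_linear_span E x : linear_span E x -> linear_span (U @` E) (U x).
Proof.
move=> [n [c [e [Ee ->]]]]; exists n, c, (U \o e); split=> [i|].
  by exists (e i).
rewrite (big_morph _ (bopD U) (bop0 U)); apply: eq_bigr => i _; exact: bopZ.
Qed.

Lemma unitary_closure_span E x :
  closure (linear_span E) x -> closure (linear_span (U @` E)) (U x).
Proof.
move=> /closure_rnormP Ex; apply/closure_rnormP => e /Ex[y Ey xy].
exists (U y); first exact: unitary_linear_span.
by rewrite -bopB unitary_rnorm.
Qed.

End UnitaryPair.

Lemma unitary_hdim U U' A k : unitary_pair U U' -> hdim A k -> hdim (U @` A) k.
Proof.
move=> Uu [E [onE <-] Ek]; exists (U @` E); [split|].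
- move=> _ _ [x Ex <-] [y Ey <-]; rewrite (unitary_inner Uu) onE//.
  by rewrite (inj_eq (can_inj (unitaryK Uu))).
- apply/seteqP; split=> [x Ux|_ [x Ex <-]]; last exact: (unitary_closure_span Uu).
  exists (U' x); last exact: (unitaryVK Uu).
  have := unitary_closure_span (unitary_pairC Uu) Ux.
  rewrite image_comp; suff -> : (U' \o U) @` E = E by [].
  apply/seteqP; split=> [_ [y Ey <-]|y Ey] /=; first by rewrite (unitaryK Uu).
  by exists y => //=; rewrite (unitaryK Uu).
- apply: card_eq_trans Ek; apply: inj_card_eq => x y _ _.
  exact/can_inj/(unitaryK Uu).
Qed.

Definition intertwined P Q := exists U U', unitary_pair U U' /\ U * P = Q * U.

Lemma intertwined_sym P Q : intertwined P Q -> intertwined Q P.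
Proof.
move=> [U [U' [Uu UP]]]; exists U', U; split; first exact: unitary_pairC.
case: Uu => UU' U'U _.
by rewrite -[LHS]mulr1 -UU' mulrA -(mulrA U') -UP mulrA U'U mul1r.
Qed.

Lemma intertwined_hdim P Q k : intertwined P Q ->
  (has_rank P k -> has_rank Q k) /\ (has_nullity P k -> has_nullity Q k).
Proof.
move=> PQ; have [V [_ [_ VQ]]] := intertwined_sym PQ.
move: PQ => [U [U' [Uu UP]]].
have UPE x : U (P x) = Q (U x) by rewrite -bop_mulE UP.
have UQE x : U' (Q x) = P (U' x).
  by rewrite -{1}(unitaryVK Uu x) -UPE (unitaryK Uu).
split=> /(unitary_hdim Uu); rewrite /has_rank /has_nullity.
  congr hdim; apply/seteqP; split=> [_ [_ [x _ <-] <-]|_ [x _ <-]].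
    by rewrite UPE; exists (U x).
  by exists (P (U' x)); [exists (U' x)|rewrite UPE (unitaryVK Uu)].
congr hdim; rewrite /nullspace; apply/seteqP; split=> [_ [x /= Px <-]|x /= Qx].
  by rewrite /= -UPE Px bop0.
by exists (U' x); [rewrite /= -UQE Qx bop0|exact: (unitaryVK Uu)].
Qed.

Section GramFamilies.
Context (I : Type).
Implicit Types e : I -> H.

Definition same_gram e e' := forall i j, inner (e i) (e j) = inner (e' i) (e' j).

(** A relation and not a function, since the coefficients of x in the family need not be unique;
    uniqueness of y comes later, from equality of the Gram matrices. *)
Definition spanned e e' x y := exists n (c : 'I_n -> R[i]) (s : 'I_n -> I),
  x = \sum_(j < n) c j *: e (s j) /\ y = \sum_(j < n) c j *: e' (s j).

Lemma inner_sum n (c : 'I_n -> R[i]) (u : 'I_n -> H) :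
  inner (\sum_(j < n) c j *: u j) (\sum_(j < n) c j *: u j) =
  \sum_(i < n) \sum_(j < n) c i * ((c j)^* * inner (u i) (u j)).
Proof.
rewrite linear_sumlz; apply: eq_bigr => i _.
rewrite linear_sumr; apply: eq_bigr => j _.
by rewrite linearZl_LR linearZr_LR.
Qed.

Lemma spanned_rnorm e e' x y : same_gram e e' -> spanned e e' x y -> rnorm x = rnorm y.
Proof.
move=> ee' [n [c [s [-> ->]]]]; apply/eqP; rewrite -(@eqrXn2 _ 2) ?rnorm_ge0//.
rewrite -!rdotxx /rdot !inner_sum; apply/eqP; congr complex.Re.
by apply: eq_bigr => i _; apply: eq_bigr => j _; rewrite ee'.
Qed.

Lemma spannedD e e' a x y x' y' : spanned e e' x y -> spanned e e' x' y' ->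
  spanned e e' (a *: x + x') (a *: y + y').
Proof.
move=> [n [c [s [-> ->]]]] [m [d [t [-> ->]]]].
exists (n + m)%N, (fun i => match fintype.split i with inl j => a * c j | inr j => d j end),
  (fun i => match fintype.split i with inl j => s j | inr j => t j end).
have E (w : I -> H) : a *: (\sum_(j < n) c j *: w (s j)) + \sum_(j < m) d j *: w (t j) =
  \sum_(j < n + m) match fintype.split j with inl j => a * c j | inr j => d j end *:
    w match fintype.split j with inl j => s j | inr j => t j end.
  rewrite big_split_ord/= scaler_sumr; congr (_ + _); apply: eq_bigr => i _.
    by rewrite (unsplitK (inl i)) scalerA.
  by rewrite (unsplitK (inr i)).
by split; exact: E.
Qed.

Lemma spannedC e e' x y : spanned e e' x y -> spanned e' e y x.
Proof. by move=> [n [c [s [-> ->]]]]; exists n, c, s. Qed.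

Lemma spanned_total e e' x : linear_span (range e) x -> exists y, spanned e e' x y.
Proof.
move=> [n [c [u [uE ->]]]].
have /choice[s us] i : exists j, e j = u i by have [j _ <-] := uE i; exists j.
exists (\sum_(j < n) c j *: e' (s j)), n, c, s; split=> //.
by apply: eq_bigr => i _; rewrite us.
Qed.

(* The closure of spanned e e' in H * H: for families with the same Gram matrix, it is
   the graph of an isometry. *)
Definition graph e e' x y := forall eps : R, 0 < eps -> exists x' y',
  [/\ spanned e e' x' y', rnorm (x - x') <= eps & rnorm (y - y') <= eps].

Lemma graph_rnorm e e' x y : same_gram e e' -> graph e e' x y -> rnorm x = rnorm y.
Proof.
move=> ee' G; apply/eqP; rewrite -subr_eq0 -normr_le0; apply/ler_addgt0Pr => eps eps0.
have [x' [y' [/(spanned_rnorm ee') xy xx' yy']]] := G _ (divr_gt0 eps0 (ltr0Sn R 1)).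
rewrite add0r ler_norml.
have := rnormD (x - x') x'; have := rnormD (x' - x) x.
have := rnormD (y - y') y'; have := rnormD (y' - y) y.
rewrite !subrK (rnormBC x' x) (rnormBC y' y).
by move=> h1 h2 h3 h4; apply/andP; split; lra.
Qed.

Lemma graphD e e' a x y x' y' : graph e e' x y -> graph e e' x' y' ->
  graph e e' (a *: x + x') (a *: y + y').
Proof.
move=> G G' eps eps0.
have a0 : 0 <= complex.Re `|a| by have := normr_ge0 a; rewrite lecE/= => /andP[].
have a1 : 0 < complex.Re `|a| + 1 by rewrite ltr_wpDl.
have e20 : 0 < eps / 2 by rewrite divr_gt0.
have [u [v [uv xu yv]]] := G _ (divr_gt0 e20 a1).
have [u' [v' [uv' xu' yv']]] := G' _ e20.
exists (a *: u + u'), (a *: v + v'); split; first exact: spannedD.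
  rewrite opprD addrACA -scalerBr; apply: le_trans (rnormD _ _) _.
  rewrite rnormZ; move: xu; rewrite ler_pdivlMr//.
  have := rnorm_ge0 (x - u); lra.
rewrite opprD addrACA -scalerBr; apply: le_trans (rnormD _ _) _.
rewrite rnormZ; move: yv; rewrite ler_pdivlMr//.
have := rnorm_ge0 (y - v); lra.
Qed.

(** By linearity 0 is related to y' - y, and related vectors have equal norms. *)
Lemma graph_fun e e' x y y' : same_gram e e' ->
  graph e e' x y -> graph e e' x y' -> y = y'.
Proof.
move=> ee' G G'; have := graph_rnorm ee' (graphD (-1) G G').
rewrite !scaleN1r addNr rnorm0 => /esym/rnorm0_eq0.
by rewrite addrC => /eqP; rewrite subr_eq0 => /eqP.
Qed.

Lemma graphC e e' x y : graph e e' x y -> graph e' e y x.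
Proof.
move=> G eps /G[x' [y' [/spannedC xy xx' yy']]].
by exists y', x'.
Qed.

Lemma graph_total e e' x : same_gram e e' ->
  closure (linear_span (range e)) x -> exists y, graph e e' x y.
Proof.
move=> ee' /closure_rnormP ex; pose r n : R := n.+1%:R^-1.
have r0 n : 0 < r n by rewrite invr_gt0 ltr0Sn.
have rmono n m : (n <= m)%N -> r m <= r n.
  by move=> nm; rewrite lef_pV2 ?posrE ?ltr0Sn// ler_nat ltnS.
have rsmall (eps : R) : 0 < eps -> exists N, forall n, (N <= n)%N -> 2 * r n <= eps.
  move=> e0; have e20 : 0 < eps / 2 by rewrite divr_gt0.
  have [N /= _ hN] := near_infty_natSinv_lt (PosNum e20).
  exists N => n /hN rn; have {rn} : r n < eps / 2 := rn.
  by move: (r n) => t; lra.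
have /choice[u uP] n : exists p : H * H, spanned e e' p.1 p.2 /\ rnorm (x - p.1) < r n.
  have [x' /(spanned_total e')[y' xy'] xx'] := ex _ (r0 n).
  by exists (x', y').
(* The partners of the approximants of x are Cauchy because differences keep their norm. *)
have uu n m : (n <= m)%N -> rnorm ((u n).2 - (u m).2) <= 2 * r n.
  move=> nm; have [sn xn] := uP n; have [sm xm] := uP m.
  have := spanned_rnorm ee' (spannedD (-1) sm sn).
  rewrite !scaleN1r ![- _ + _]addrC => <-.
  have := rnorm_triangle x (u n).1 (u m).1.
  by rewrite (rnormBC _ x); have := rmono _ _ nm; lra.
have [y yu] := rnorm_complete uu rsmall.
exists y => eps eps0; have [N /(_ N (leqnn _)) hN] := rsmall _ eps0.
have [sN xN] := uP N; exists (u N).1, (u N).2; split=> //.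
  by have := r0 N; lra.
exact: le_trans (yu N) hN.
Qed.

Lemma graph_bop e e' : same_gram e e' -> closure (linear_span (range e)) = setT ->
  exists U, forall x, graph e e' x (U x).
Proof.
move=> ee' eT.
have /choice[U GU] x : exists y, graph e e' x y by apply: graph_total => //; rewrite eT.
have Ub : U \in @bounded_operator R H.
  apply: bounded_operatorP => [a x y|].
    exact: graph_fun ee' (GU _) (graphD _ (GU _) (GU _)).
  by exists 1 => x; rewrite mul1r (graph_rnorm ee' (GU x)).
by exists (BOp Ub).
Qed.

Lemma unitary_of_families e e' : same_gram e e' ->
  closure (linear_span (range e)) = setT -> closure (linear_span (range e')) = setT ->
  exists U U', unitary_pair U U' /\ forall i, U (e i) = e' i.
Proof.
move=> ee' eT e'T; have e'e : same_gram e' e by move=> i j; rewrite ee'.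
have [U GU] := graph_bop ee' eT; have [U' GU'] := graph_bop e'e e'T.
have UU' x : U (U' x) = x by apply: (graph_fun ee' (GU _)); exact/graphC.
have U'U x : U' (U x) = x by apply: (graph_fun e'e (GU' _)); exact/graphC.
have Unorm x : rnorm (U x) = rnorm x by rewrite (graph_rnorm ee' (GU x)).
exists U, U'; split; first split.
- exact: bop_ext.
- exact: bop_ext.
(* Polarization: x + U' y and its image have the same norm, and so do the summands, hence the cross
   terms agree. *)
- move=> x y; rewrite -{1}(UU' y).
  have := rnormD_sqr (U x) (U (U' y)); rewrite -bopD !Unorm rnormD_sqr; lra.
- move=> i; apply: (graph_fun ee' (GU _)) => eps eps0.
  exists (e i), (e' i); rewrite !subrr rnorm0 ltW//; split=> //.
  by exists 1%N, (fun=> 1), (fun=> i); rewrite !big_ord1 !scale1r.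
Qed.

End GramFamilies.

(** Turns a basis of cardinality [k] into a family indexed by [k]. The Gram matrix tests equality in
    [H] because [k] is a bare type. *)
Lemma hdim_family A k : hdim A k -> exists e : k -> H,
  [/\ injective e, forall i j, inner (e i) (e j) = (e i == e j)%:R &
      closure (linear_span (range e)) = A].
Proof.
move=> [E [onE EA]]; rewrite card_eq_sym => /card_set_bijP[e [eE einj eonto]].
have {}eE i : E (e i) by exact: eE.
have rE : range e = E by apply/seteqP; split=> [_ [i _ <-]|x /eonto].
exists e; split=> [i j eij|i j|]; last by rewrite rE.
  by apply: einj => //; rewrite inE.
by rewrite onE.
Qed.

Lemma proj_orthogonal P x y : projections P -> P x = x -> P y = 0 -> inner x y = 0.
Proof. by move=> [_ Psa] <- Py; rewrite Psa Py linear0r. Qed.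

Lemma range_fixed P x : projections P -> range P x -> P x = x.
Proof. by move=> [PP _] [y _ <-]. Qed.

Definition sum_family (k l : Type) (e : k -> H) (f : l -> H) (i : k + l) :=
  match i with inl i => e i | inr i => f i end.

Theorem intertwined_of_hdim P Q k l : projections P -> projections Q ->
  has_rank P k -> has_nullity P l -> has_rank Q k -> has_nullity Q l ->
  intertwined P Q.
Proof.
have fam P' : projections P' -> has_rank P' k -> has_nullity P' l ->
    exists (e : k -> H) (f : l -> H),
    [/\ (forall i, P' (e i) = e i) /\ (forall i, P' (f i) = 0),
        injective e /\ injective f,
        (forall i j, inner (e i) (e j) = (e i == e j)%:R) /\
        (forall i j, inner (f i) (f j) = (f i == f j)%:R) &
        closure (linear_span (range (sum_family e f))) = setT].
  move=> pP /hdim_family[e [einj eon eA]] /hdim_family[f [finj fon fA]].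
  have sub A B : A `<=` B -> closure (linear_span A) `<=` closure (linear_span B).
    move=> AB; apply: closureS; apply: linear_span_min; first exact: linear_span_subspace.
    by move=> x /AB; exact: sub_linear_span.
  have incl A x : A x -> closure (linear_span A) x.
    by move=> Ax; apply: subset_closure; exact: sub_linear_span.
  exists e, f; split=> //.
    split=> i; first by apply: range_fixed => //; rewrite -eA; apply: incl; exists i.
    by rewrite -[_ = _]/(nullspace P' _) -fA; apply: incl; exists i.
  apply/seteqP; split=> // x _; rewrite -(subrK (P' x) x).
  apply: (subspaceD (subspace_closure (linear_span_subspace _))).
    apply: (sub (range f)); first by move=> _ [i _ <-]; exists (inr i).
    by rewrite fA -[nullspace _ _]/(_ = 0) bopB; case: pP => -> _; rewrite subrr.
  apply: (sub (range e)); first by move=> _ [i _ <-]; exists (inl i).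
  by rewrite eA; exists x.
move=> pP pQ rP nP rQ nQ.
have [e [f [[Pe Pf] [einj finj] [eon fon] efT]]] := fam _ pP rP nP.
have [e' [f' [[Qe Qf] [e'inj f'inj] [e'on f'on] ef'T]]] := fam _ pQ rQ nQ.
have gram : same_gram (sum_family e f) (sum_family e' f').
  have eqb (T T' : eqType) (J : Type) (u : J -> T) (v : J -> T') i j :
      injective u -> injective v -> (u i == u j) = (v i == v j).
    by move=> ui vi; apply/eqP/eqP => [/ui ->|/vi ->].
  move=> [i|i] [j|j] /=.
  - by rewrite eon e'on (eqb _ _ _ e e').
  - by rewrite (proj_orthogonal pP)// (proj_orthogonal pQ).
  - by rewrite innerC (proj_orthogonal pP)// innerC (proj_orthogonal pQ).
  - by rewrite fon f'on (eqb _ _ _ f f').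
have [U [U' [Uu Ue]]] := unitary_of_families gram efT ef'T.
exists U, U'; split=> //; apply: bop_ext => x; rewrite !bop_mulE.
apply/eqP; rewrite -subr_eq0; apply/eqP.
have : closure (linear_span (range (sum_family e f))) x by rewrite efT.
(* [U * P] and [Q * U] agree on a family with dense span: both send e i to e' i and f i to 0. *)
apply: (nullspace_closure_span (T := U * P - Q * U)) => _ [i _ <-].
have := Ue i; rewrite !bopE; case: i => i /= Uei.
  by rewrite Pe Uei Qe subrr.
by rewrite Pf Uei Qf bop0 subrr.
Qed.

End Unitaries.

(** * Constructions of unitaries *)

Section Factorization.
Context (R : realType) (H : hilbertType R).
Implicit Types (f g P Q U V : bop H) (x y z : H).

Lemma half_add (W : lmodType R[i]) (x : W) : (2^-1)%:C *: (x + x) = x.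
Proof.
rewrite scalerDr -scalerDl -rmorphD/=.
have -> : 2^-1 + 2^-1 = 1 :> R by lra.
by rewrite scale1r.
Qed.

Lemma adjoint_inverse f f' g g' : adjoint f f' -> f * g = 1 -> f' * g' = 1 -> adjoint g g'.
Proof.
move=> ff' fg f'g' x y.
by rewrite -[in LHS](bop_1E y) -f'g' bop_mulE -ff' -bop_mulE fg.
Qed.

Lemma projections_adjoint P : projections P <-> P * P = P /\ adjoint P P.
Proof.
split=> [[PP /selfadjointP aP]|[PP /selfadjointP aP]]; split=> //.
  exact: bop_ext.
by move=> x; rewrite -bop_mulE PP.
Qed.

Lemma reflection_sqr P : P * P = P -> (P + P - 1) * (P + P - 1) = 1.
Proof.
move=> PP; have SP : (P + P - 1) * P = P by rewrite mulrBl mulrDl PP mul1r addrK.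
by rewrite mulrBr mulrDr SP mulr1 subKr.
Qed.

Lemma reflection_adjoint P : adjoint P P -> adjoint (P + P - 1) (P + P - 1).
Proof. by move=> aP; apply: adjointB => //; exact: adjointD. Qed.

Lemma sqrB_involution (s t : bop H) : s * s = 1 -> t * t = 1 ->
  (s - t) * (s - t) = (1 - s * t) + (1 - t * s).
Proof.
by move=> ss tt; rewrite mulrBl !mulrBr ss tt opprB [in RHS]addrC addrC.
Qed.

(** With d = s - t one has t d = - d s and s d = - d t, so t passes d twice and comes out
    unchanged. *)
Lemma comm_sqrB_involution (s t : bop H) : s * s = 1 -> t * t = 1 ->
  GRing.comm t ((s - t) * (s - t)).
Proof.
move=> ss tt; pose d : bop H := s - t.
have td : t * d = - (d * s) by rewrite mulrBr mulrBl ss tt opprB.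
have sd : - (s * d) = d * t by rewrite mulrBr mulrBl ss tt opprB.
by rewrite /GRing.comm -/d mulrA td mulNr -(mulrA d s d) -(mulrN d) sd mulrA.
Qed.

(* For s = 2P - 1 and t = 2Q - 1, the operator G = (1 + ts) / 2 satisfies Gs = tG and
   G^* G = G G^* = 1 - (P - Q)^2; the unitary is G |G|^-1. *)
Theorem near_intertwined P Q : projections P -> projections Q ->
  opnorm (P - Q) <= 1 / 2 -> intertwined P Q.
Proof.
move=> /projections_adjoint[PP aP] /projections_adjoint[QQ aQ] PQ.
pose s : bop H := P + P - 1; pose t : bop H := Q + Q - 1.
have ss : s * s = 1 by exact: reflection_sqr.
have tt : t * t = 1 by exact: reflection_sqr.
have a_s : adjoint s s by exact: reflection_adjoint.
have a_t : adjoint t t by exact: reflection_adjoint.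
have st1 : opnorm (s - t) <= 1.
  have -> : s - t = (P - Q) + (P - Q).
    by rewrite /s /t opprB addrA subrK opprD addrACA.
  by apply: le_trans (opnormD _ _) _; lra.
have eP : P = (2^-1)%:C *: (s + 1) by rewrite subrK half_add.
have eQ : Q = (2^-1)%:C *: (t + 1) by rewrite subrK half_add.
clearbody s t.
have ats : adjoint (s - t) (s - t) by exact: adjointB.
pose Z : bop H := (s - t) * (s - t).
have aZ : adjoint Z Z by exact: adjointM.
have tZ : GRing.comm t Z by exact: comm_sqrB_involution.
have sZ : GRing.comm s Z.
  by rewrite /Z -[s - t]opprB mulrNN; exact: comm_sqrB_involution.
(* Since s - t = 2 (P - Q), [X] is (P - Q)^2, and the hypothesis makes its norm at most 1/4. *)
pose X : bop H := (4^-1)%:C *: Z.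
have aX : adjoint X X by exact: adjointZr.
have Z1 : opnorm Z <= 1 by rewrite -[X in _ <= X](mulr1 1); exact: opnorm_mul_le.
have X4 : opnorm X <= 4^-1.
  by rewrite opnormZr ger0_norm ?invr_ge0//; lra.
have [|B [BB aB _ commB]] := bop_sqrt aX; first by lra.
(* 1 - X lies between 3/4 and 5/4, so the factor 4/3 brings it between the bounds 1 and 2 of
   [coercive_inverse]. *)
have [|x|F [DF FD _ commF]] := @coercive_inverse _ _ ((4 / 3)%:C *: (1 - X)).
- move=> x; rewrite bopE rdotZl bop_addE bop_1E bop_oppE rdotBl rdotxx.
  have := rdot_le (X x) x; have := rnorm_le_opnorm X x.
  have := rnorm_ge0 x; have := rnorm_ge0 (X x); have := opnorm_ge0 X; nra.
- rewrite bop_scaleE rnormZr bop_addE bop_1E bop_oppE.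
  have := rnormD x (- X x); rewrite rnormN.
  have := rnorm_le_opnorm X x; rewrite ger0_norm; last by lra.
  have := rnorm_ge0 x; have := rnorm_ge0 (X x); have := opnorm_ge0 X; nra.
(* B^-1 = B (B^2)^-1, where B^2 = 1 - X has the inverse (4/3) F. *)
pose Binv : bop H := B * ((4 / 3)%:C *: F).
have commX Y : GRing.comm Y Z -> GRing.comm Y X by move=> ?; exact: commZr.
have commBinv Y : GRing.comm Y Z -> GRing.comm Y Binv.
  move=> /commX YX; apply: commrM; first exact: commB.
  apply: commZr; apply: commF; apply: commZr; apply: commrB => //; exact: commr1.
have BB1 : B * Binv = 1.
  by rewrite /Binv mulrA BB -bop_scaleAr bop_scaleAl.
have ZB : GRing.comm Z B by apply: commB; exact: commZr.
have BinvB : Binv * B = 1 by rewrite -[LHS](commBinv B (commr_sym ZB)).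
have aBinv : adjoint Binv Binv by exact: (adjoint_inverse aB BB1 BB1).
pose G : bop H := (2^-1)%:C *: (1 + t * s).
pose G' : bop H := (2^-1)%:C *: (1 + s * t).
(* Stated for any two involutions, to yield both G' G and G G'. The product (1 + uv) (1 + vu) is 2 +
   uv + vu, and adding Z = 2 - uv - vu gives 4. *)
have GG (u v : bop H) : u * u = 1 -> v * v = 1 -> (u - v) * (u - v) = Z ->
    (2^-1)%:C *: (1 + u * v) * ((2^-1)%:C *: (1 + v * u)) = B * B.
  move=> uu vv uvZ; rewrite BB -bop_scaleAl -bop_scaleAr scalerA -rmorphM/=.
  have e : (1 + u * v) * (1 + v * u) = (1 + u * v) + (1 + v * u).
    rewrite mulrDr mulr1 mulrDl mul1r -mulrA (mulrA v) vv mul1r uu.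
    by rewrite [v * u + 1]addrC.
  have e4 : (4^-1)%:C *: ((1 + u * v) + (1 + v * u) + Z) = 1.
    rewrite -uvZ sqrB_involution// addrACA.
    rewrite [1 + u * v + _]addrACA subrr addr0 [1 + v * u + _]addrACA subrr addr0.
    have -> : (4^-1 : R) = 2^-1 * 2^-1 by lra.
    by rewrite rmorphM/= -scalerA !half_add.
  rewrite e; have -> : (2^-1 * 2^-1 : R) = 4^-1 by lra.
  by rewrite -[in RHS]e4 [in RHS]scalerDr -/X addrK.
have G'G : G' * G = B * B by exact: GG.
have GG' : G * G' = B * B by apply: GG => //; rewrite -[t - s]opprB mulrNN.
have commG : GRing.comm G Binv.
  apply: commr_sym; apply: commZr; apply: commrD; first exact: commr1.
  by apply: commrM; apply: commr_sym; exact: commBinv.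
have aG : adjoint G G' by apply: adjointZr; apply: adjointD => //; exact: adjointM.
exists (G * Binv), (Binv * G'); split; first split.
- rewrite mulrA commG -(mulrA Binv) commG.
  by rewrite -mulrA -(mulrA Binv G) GG' (mulrA Binv B) BinvB mul1r.
- by rewrite mulrA -(mulrA Binv) G'G mulrA BinvB mul1r BB1.
- exact: adjointM.
have Gs : G * s = t * G.
  rewrite /G -bop_scaleAl -bop_scaleAr mulrDl mulrDr mul1r mulr1 -mulrA ss mulr1.
  by rewrite mulrA tt mul1r addrC.
have Us : G * Binv * s = t * (G * Binv).
  by rewrite -mulrA -(commBinv s)// mulrA Gs mulrA.
by rewrite eP eQ -bop_scaleAr -[in RHS]bop_scaleAl mulrDr mulrDl mulr1 mul1r Us.
Qed.

Lemma adjoint_re f f' : adjoint f f' -> forall x, 2 * rdot (f x) x = rdot ((f + f') x) x.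
Proof. by move=> a x; rewrite bop_addE rdotDl (rdotC (f' x)) -a; lra. Qed.

(** The nullspace of [T] reduces f: its invariance under f gives f E = E f E, and its invariance
    under the adjoint f' gives E f = E f E. *)
Lemma comm_projection (E T : bop H) f f' : projections E -> (forall x, T x = 0 <-> E x = x) ->
  adjoint f f' -> GRing.comm f T -> GRing.comm f' T -> GRing.comm f E.
Proof.
move=> /projections_adjoint[EE aE] ET ff' fT f'T.
have stable h : GRing.comm h T -> E * h * E = h * E.
  move=> hT; apply: bop_ext => x; rewrite !bop_mulE; apply/ET.
  rewrite -bop_mulE -hT bop_mulE; have -> : T (E x) = 0; last by rewrite bop0.
  by apply/ET; rewrite -bop_mulE EE.
rewrite /GRing.comm -(stable _ fT); apply: bop_ext => x; apply: rdot_inj => y.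
by rewrite !bop_mulE aE ff' aE -!bop_mulE [in RHS]bop_mulE aE ff' -!bop_mulE stable.
Qed.

(* S is the sign of A with respect to B = |A|, with value 1 on the kernel of B - A. *)
Lemma polar_reflection (A B : bop H) :
  adjoint A A -> adjoint B B -> GRing.comm A B -> A * A = B * B ->
  exists S, [/\ S * S = 1, adjoint S S, S * A = B, A * S = B &
    forall f f', adjoint f f' -> GRing.comm f A -> GRing.comm f B ->
      GRing.comm f' A -> GRing.comm f' B -> GRing.comm f S].
Proof.
move=> aA aB AB AABB.
have [E pE EN] := projection_onto (nullspace_subspace (B - A)) (@nullspace_closed _ _ (B - A)).
have {}EN x : (B - A) x = 0 <-> E x = x by exact: EN.
have [EE aE] := (projections_adjoint E).1 pE.
have BAE : B * E = A * E.
  apply: bop_ext => x; apply/eqP; rewrite -subr_eq0 -[_ - _]/(((B - A) * E) x); apply/eqP.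
  by apply/EN; rewrite -bop_mulE EE.
(* (B - A) (B + A) = 0, so the range of B + A lies in that of [E]. Then A (2E - 1) = (B + A) E - A =
   B. *)
have EBA : E * (B + A) = B + A.
  apply: bop_ext => x; apply/EN; rewrite -bop_mulE mulrDr !mulrBl AABB AB.
  by rewrite addrA subrK subrr.
have BAE' : (B + A) * E = B + A.
  apply: bop_ext => x; apply: rdot_inj => y.
  have aBA : adjoint (B + A) (B + A) by exact: adjointD.
  by rewrite bop_mulE aBA aE -bop_mulE EBA -aBA.
have comE f f' : adjoint f f' -> GRing.comm f A -> GRing.comm f B ->
      GRing.comm f' A -> GRing.comm f' B -> GRing.comm f (E + E - 1).
  move=> aff fA fB f'A f'B; apply: commrB; last exact: commr1.
  have fE : GRing.comm f E by apply: (comm_projection pE EN aff); exact: commrB.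
  exact: commrD.
have AS : A * (E + E - 1) = B.
  by rewrite mulrBr mulr1 mulrDr -{1}BAE -mulrDl BAE' addrK.
exists (E + E - 1); split=> //.
- exact: reflection_sqr.
- exact: reflection_adjoint.
- by rewrite -(comE A A).
Qed.

Definition accretive f := forall x, 0 <= rdot (f x) x.

(* If S is the sign of Im U, then -iSU has real part |Im U| and iS has real part 0. *)
Theorem unitary_factor U U' : unitary_pair U U' -> exists V1 V1' V2 V2',
  [/\ unitary_pair V1 V1', unitary_pair V2 V2', accretive V1, accretive V2 & U = V1 * V2].
Proof.
move=> Uu; have [UU' U'U aU] := Uu.
have aU' := adjointC aU.
(* [X] is Re U and [A] is Im U, with U = X - K and U' = X + K. *)
pose X : bop H := (2^-1)%:C *: (U + U').
pose K : bop H := (2^-1)%:C *: (U' - U).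
pose A : bop H := 'i *: K.
have comUX : GRing.comm U X by apply: commZr; apply: commrD => //; rewrite /GRing.comm UU'.
have comU'X : GRing.comm U' X by apply: commZr; apply: commrD => //; rewrite /GRing.comm UU'.
have comUK : GRing.comm U K by apply: commZr; apply: commrB => //; rewrite /GRing.comm UU'.
have comU'K : GRing.comm U' K by apply: commZr; apply: commrB => //; rewrite /GRing.comm UU'.
have comUA : GRing.comm U A by exact: commZr.
have comU'A : GRing.comm U' A by exact: commZr.
have aX : adjoint X X.
  by rewrite /X {2}[U + U']addrC; apply: adjointZr; exact: adjointD.
have aA : adjoint A A.
  have : adjoint K (- K).
    by rewrite /K -scalerN opprB; apply: adjointZr; exact: adjointB.
  by move=> /adjoint_i; rewrite scaleNr scalerN opprK.
have aXX : adjoint (X * X) (X * X) by exact: adjointM.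
have X1 : opnorm X <= 1.
  rewrite opnormZr ger0_norm ?invr_ge0//.
  have := opnormD U U'; have := unitary_opnorm Uu.
  by have := unitary_opnorm (unitary_pairC Uu); lra.
have XX1 : opnorm (X * X) <= 1 by rewrite -[X in _ <= X](mulr1 1); exact: opnorm_mul_le.
have [B [BB aB Bpos comB]] := bop_sqrt aXX XX1.
(* 1 = U U' = (X - K) (X + K) = X^2 - K^2 and A^2 = - K^2; thus [B] is |Im U|. *)
have AA : A * A = B * B.
  rewrite BB; apply/eqP; rewrite eq_sym subr_eq; apply/eqP.
  rewrite /A -bop_scaleAl -bop_scaleAr scalerA -expr2 sqr_i scaleN1r.
  have XK : GRing.comm X K.
    by apply/commr_sym; apply: commZr; apply: commrD; exact: commr_sym.
  have XpK : X + K = U' by rewrite -scalerDr [U + U']addrC addrACA subrr addr0 half_add.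
  have XmK : X - K = U by rewrite -scalerBr opprB addrACA subrr addr0 half_add.
  by rewrite -UU' -{1}XmK -XpK mulrBl !mulrDr XK opprD addrA addrK addrC.
have comUB : GRing.comm U B by apply: comB; exact: commrM.
have comU'B : GRing.comm U' B by apply: comB; exact: commrM.
have comAB : GRing.comm A B.
  apply: commr_sym; do 2!apply: commZr; apply: commrB; exact: commr_sym.
have [S [SS aS SA AS comS]] := polar_reflection aA aB comAB AA.
have comUS : GRing.comm U S by exact: (comS _ _ aU).
have comU'S : GRing.comm U' S by exact: (comS _ _ aU').
have iS : unitary_pair ('i *: S) (- 'i *: S).
  split; last exact: adjoint_i.
    by rewrite -bop_scaleAl -bop_scaleAr scalerA mulrN -expr2 sqr_i opprK SS scale1r.
  by rewrite -bop_scaleAl -bop_scaleAr scalerA mulNr -expr2 sqr_i opprK SS scale1r.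
exists ('i *: S), (- 'i *: S), (- 'i *: S * U), (U' * ('i *: S)); split=> //.
- by apply: unitary_pairM => //; exact: unitary_pairC.
- move=> x; have [_ _ /adjoint_re/(_ x)] := iS.
  by rewrite scaleNr subrr bop_0E rdot0l; lra.
- move=> x; have aV : adjoint (- 'i *: S * U) (U' * ('i *: S)).
    by apply: adjointM => //; apply: adjointC; exact: adjoint_i.
  have := adjoint_re aV x.
  have -> : - 'i *: S * U + U' * ('i *: S) = B + B.
    have KK : U' - U = K + K by rewrite -[LHS]half_add scalerDr.
    rewrite scaleNr mulNr -bop_scaleAl -bop_scaleAr -comUS addrC -scalerBr -mulrBl KK.
    by rewrite mulrDl scalerDr [in LHS]bop_scaleAl -/A AS.
  by rewrite bop_addE rdotDl; have := Bpos x; lra.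
- rewrite mulrA -bop_scaleAl -bop_scaleAr scalerA mulrN -expr2 sqr_i opprK SS.
  by rewrite scale1r mul1r.
Qed.

End Factorization.

(** * Paths of unitaries *)

Section Paths.
Context (R : realType) (H : hilbertType R).
Implicit Types (f g P Q U V : bop H) (x y z : H).

Lemma resolvent V V' : unitary_pair V V' -> accretive V ->
  exists E : R -> bop H, forall r, 0 <= r <= 1 ->
    [/\ (1 + r%:C *: V) * E r = 1, E r * (1 + r%:C *: V) = 1, opnorm (E r) <= 1 &
      forall Z, GRing.comm Z V -> GRing.comm Z (E r)].
Proof.
move=> Vu Vpos.
suff /choice[E EP] : forall r : R, exists E : bop H, 0 <= r <= 1 ->
    [/\ (1 + r%:C *: V) * E = 1, E * (1 + r%:C *: V) = 1, opnorm E <= 1 &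
      forall Z, GRing.comm Z V -> GRing.comm Z E] by exists E.
(* Choice needs a value at every real r; outside [0, 1] the value 0 is arbitrary. *)
move=> r; have [/andP[r0 r1]|] := boolP (0 <= r <= 1); last by exists 0.
have [|x|E [DE ED E1 comE]] := @coercive_inverse _ _ (1 + r%:C *: V).
- move=> x; rewrite bop_addE bop_1E bop_scaleE rdotDl rdotZl rdotxx.
  by have := Vpos x; nra.
- rewrite bop_addE bop_1E bop_scaleE; apply: le_trans (rnormD _ _) _.
  rewrite rnormZr ger0_norm// (unitary_rnorm Vu).
  by have := rnorm_ge0 x; nra.
exists E => _; split=> // Z ZV; apply: comE.
by apply: commrD; [exact: commr1|exact: commZr].
Qed.

(* For unitary V this joins V (at r = 0) to 1 (at r = 1) through unitaries, where E r is
   the inverse of 1 + rV, which exists for all r in [0, 1] when Re V >= 0. *)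
Definition cayley V (E : R -> bop H) (r : R) : bop H := (r%:C *: (1 : bop H) + V) * E r.

Lemma cayley_lipschitz V V' (E : R -> bop H) r s : unitary_pair V V' ->
  0 <= r <= 1 -> 0 <= s <= 1 ->
  E r * (1 + r%:C *: V) = 1 -> (1 + s%:C *: V) * E s = 1 ->
  opnorm (E r) <= 1 -> opnorm (E s) <= 1 ->
  opnorm (cayley V E r - cayley V E s) <= 3 * `|r - s|.
Proof.
move=> Vu r01 s01 ED DE Er Es.
have V1 := unitary_opnorm Vu.
have Ers : opnorm (E r - E s) <= `|r - s|.
  (* The resolvent identity. *)
  have -> : E r - E s = E r * (((s - r)%:C *: V) * E s).
    have -> : (s - r)%:C *: V = (1 + s%:C *: V) - (1 + r%:C *: V).
      by rewrite rmorphB/= scalerBl opprD addrACA subrr add0r.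
    by rewrite mulrBl DE mulrBr mulr1 mulrA ED mul1r.
  rewrite -[X in _ <= X]mul1r; apply: opnorm_mul_le => //.
  rewrite -[X in _ <= X]mulr1; apply: opnorm_mul_le => //.
  by rewrite opnormZr distrC -[X in _ <= X]mulr1 ler_wpM2l.
(* The constant 3 is 1 + 2: |E r| <= 1 in the first term, |s + V| <= 2 in the second. *)
have -> : cayley V E r - cayley V E s =
    (r - s)%:C *: E r + (s%:C *: (1 : bop H) + V) * (E r - E s).
  rewrite /cayley mulrBr addrA; congr (_ - _).
  rewrite !mulrDl addrA -!bop_scaleAl !mul1r -scalerDl -rmorphD/=.
  by rewrite subrK.
apply: le_trans (opnormD _ _) _.
have sV : opnorm (s%:C *: (1 : bop H) + V) <= 2.
  apply: le_trans (opnormD _ _) _; rewrite opnormZr.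
  have /andP[s0 s1] := s01; rewrite ger0_norm//; have := opnorm1 H; nra.
have := opnorm_mul_le sV Ers; rewrite opnormZr.
have : `|r - s| * opnorm (E r) <= `|r - s| * 1 by rewrite ler_wpM2l.
lra.
Qed.

Lemma conjugate_projection U U' P : unitary_pair U U' -> projections P ->
  projections (U * P * U') /\ intertwined P (U * P * U').
Proof.
move=> Uu /projections_adjoint[PP aP]; have [UU' U'U aU] := Uu; split; last first.
  by exists U, U'; split=> //; rewrite -[in RHS]mulrA U'U mulr1.
apply/projections_adjoint; split.
  by rewrite !mulrA -(mulrA (U * P) U') U'U mulr1 -(mulrA U P P) PP.
rewrite -[X in adjoint _ X]mulrA; apply: adjointM; last exact: adjointC.
exact: adjointM.
Qed.

Theorem accretive_path V V' P : unitary_pair V V' -> accretive V -> projections P ->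
  exists (c : R -> bop H) (C : R),
  [/\ c 0 = V * P * V', c 1 = P,
      forall r, 0 <= r <= 1 -> projections (c r) /\ intertwined P (c r) &
      forall r s, 0 <= r <= 1 -> 0 <= s <= 1 -> opnorm (c r - c s) <= C * `|r - s|].
Proof.
move=> Vu Vpos /projections_adjoint[PP aP]; have [VV' V'V aV] := Vu.
have V'u := unitary_pairC Vu.
have V'pos : accretive V'.
  by move=> x; rewrite rdotC -aV; exact: Vpos.
have [E EP] := resolvent Vu Vpos; have [E' E'P] := resolvent V'u V'pos.
have comVV' : GRing.comm V V' by rewrite /GRing.comm VV'.
pose W := cayley V E; pose W' := cayley V' E'.
have Wu r : 0 <= r <= 1 -> unitary_pair (W r) (W' r).
  move=> r01; have [DE ED _ comE] := EP r r01; have [D'E' E'D' _ comE'] := E'P r r01.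
  set D : bop H := 1 + r%:C *: V; set D' : bop H := 1 + r%:C *: V'.
  set N : bop H := r%:C *: (1 : bop H) + V; set N' : bop H := r%:C *: (1 : bop H) + V'.
  (* Both sides equal 1 + r^2 + r (V + V'). This identity is what makes [W r] unitary. *)
  have NN' : N * N' = D * D'.
    have swap (a b c d : bop H) : (a + b) + (c + d) = (d + b) + (c + a).
      by rewrite addrC (addrC c) (addrC a) addrACA.
    rewrite [LHS]mulrDl [RHS]mulrDl -!bop_scaleAl !mul1r mulrDr VV' -bop_scaleAr mulr1.
    by rewrite [V * D']mulrDr -[V * (_ *: V')]bop_scaleAr VV' mulr1 !scalerDr swap.
  have comVE : GRing.comm V (E r) by apply: comE.
  have comV'E : GRing.comm V' (E r) by apply: comE; exact: commr_sym.
  have comVE' : GRing.comm V (E' r) by apply: comE'.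
  have comV'E' : GRing.comm V' (E' r) by apply: comE'.
  have comEE' : GRing.comm (E r) (E' r).
    by apply: comE'; apply: commr_sym.
  have comN'E : GRing.comm N' (E r).
    by apply/commr_sym; apply: commrD; [apply: commZr; exact: commr1|exact: commr_sym].
  have comNE : GRing.comm N (E r).
    by apply/commr_sym; apply: commrD; [apply: commZr; exact: commr1|exact: commr_sym].
  have comN'E' : GRing.comm N' (E' r).
    by apply/commr_sym; apply: commrD; [apply: commZr; exact: commr1|exact: commr_sym].
  have comNE' : GRing.comm N (E' r).
    by apply/commr_sym; apply: commrD; [apply: commZr; exact: commr1|exact: commr_sym].
  have comNN' : GRing.comm N N'.
    by apply: commrD; [apply: commZr; exact: commr1|];
       apply/commr_sym; apply: commrD; [apply: commZr; exact: commr1|].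
  have WW' : W r * W' r = 1.
    rewrite /W /W' /cayley -/N -/N' mulrA -(mulrA N) -comN'E (mulrA N) NN'.
    by rewrite -!mulrA comEE' (mulrA D') D'E' mul1r DE.
  split=> //.
    rewrite -[RHS]WW' /W /W' /cayley -/N -/N'.
    rewrite mulrA -(mulrA N') -comNE' (mulrA N') -comNN' -(mulrA (N * N')) -comEE'.
    by rewrite mulrA -(mulrA N N') comN'E !mulrA.
  rewrite /W' /cayley -/N' comN'E'; apply: adjointM.
    by apply: adjointD => //; exact: adjointZr.
  apply: (adjoint_inverse _ DE D'E'); apply: adjointD => //; exact: adjointZr.
have c01 : 0 <= (0 : R) <= 1 by rewrite lexx ler01.
have c11 : 0 <= (1 : R) <= 1 by rewrite lexx ler01.
(* [W] and [W'] are both 3-Lipschitz and of norm at most 1, whence the 6. *)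
exists (fun r => W r * P * W' r), (6 * opnorm P); split.
- have [+ _ _ _] := EP 0 c01; have [+ _ _ _] := E'P 0 c01.
  rewrite /W /W' /cayley !scale0r !addr0 !add0r !mul1r => -> ->.
  by rewrite !mulr1.
- have [+ _ _ _] := EP 1 c11; have [+ _ _ _] := E'P 1 c11.
  rewrite /W /W' /cayley !scale1r => -> ->.
  by rewrite mulr1 mul1r.
- by move=> r /Wu Wr; apply: conjugate_projection => //; exact/projections_adjoint.
- move=> r s r01 s01.
  have [_ ED Er _] := EP r r01; have [_ E'D Er' _] := E'P r r01.
  have [DE _ Es _] := EP s s01; have [D'E _ Es' _] := E'P s s01.
  have h := cayley_lipschitz Vu r01 s01 ED DE Er Es.
  have h' := cayley_lipschitz V'u r01 s01 E'D D'E Er' Es'.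
  have w1 := unitary_opnorm (Wu _ s01).
  have w2 := unitary_opnorm (unitary_pairC (Wu _ r01)).
  have -> : W r * P * W' r - W s * P * W' s =
      (W r - W s) * P * W' r + W s * P * (W' r - W' s).
    by rewrite mulrBr !mulrBl addrA subrK.
  apply: le_trans (opnormD _ _) _.
  have := opnorm_mul_le (opnorm_mul_le h (lexx (opnorm P))) w2.
  have := opnorm_mul_le (opnorm_mul_le w1 (lexx (opnorm P))) h'.
  rewrite /W /W'; lra.
Qed.

Lemma lipschitz_within (V : normedModType R[i]) (c : R -> V) (C : R) :
  (forall r s, 0 <= r <= 1 -> 0 <= s <= 1 -> rnorm (c r - c s) <= C * `|r - s|) ->
  {within `[0, 1]%classic, continuous c}.
Proof.
move=> cC; apply/subspace_continuousP => x x01.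
apply/cvgrPdist_le => e; rewrite ltcE => /andP[/= /eqP e0 egt0].
have C1 : 0 < `|C| + 1 by rewrite ltr_wpDl.
have : \forall y \near x, `|x - y| <= complex.Re e / (`|C| + 1).
  have /cvgrPdist_le cx : y @[y --> x] --> x by exact: cvg_id.
  by apply: cx; rewrite divr_gt0.
rewrite /prop_near1 /within /nbhs/= => xe.
near=> y => y01; rewrite lecE normE/= e0 eqxx/=.
have /(le_trans (cC _ _ x01 y01)) : C * `|x - y| <= complex.Re e; last by [].
have : `|x - y| <= complex.Re e / (`|C| + 1) by near: y.
rewrite ler_pdivlMr// => h; apply: le_trans h; rewrite mulrC ler_wpM2l//.
by have := ler_norm C; lra.
Unshelve. all: by end_near. Qed.

End Paths.

(** * Connected components *)

Section Components.
Context (R : realType) (H : hilbertType R).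
Implicit Types (P Q : bop H) (p q : bop H * bop H) (k l m n : Type).

Lemma connected_path (c : R -> bop H) (C : R) :
  (forall r s, 0 <= r <= 1 -> 0 <= s <= 1 -> opnorm (c r - c s) <= C * `|r - s|) ->
  connected (c @` `[0, 1]%classic).
Proof.
move=> cC; apply: connected_continuous_connected (@segment_connected R 0 1) _.
exact: (lipschitz_within (C := C)).
Qed.

Section SlotDeformation.
Context (F : bop H -> bop H * bop H) (A : set (bop H * bop H)).
Hypothesis Fcont : continuous F.
Hypothesis AF : forall P Q, projections Q -> intertwined P Q -> A (F P) -> A (F Q).

(** [F] will be T => (T, Q) and then T => (P', T), so one argument serves both slots. The path
    starts at V P V' and ends at P. *)
Lemma accretive_component P V V' : unitary_pair V V' -> accretive V ->
  projections P -> A (F P) -> connected_component A (F P) (F (V * P * V')).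
Proof.
move=> Vu Vpos pP AP; have [c [C [c0 c1 cP cC]]] := accretive_path Vu Vpos pP.
have c0in : (c @` `[0, 1]%classic) (V * P * V').
  by exists 0; rewrite //= in_itv/= lexx ler01.
have c1in : (c @` `[0, 1]%classic) P.
  by exists 1; rewrite //= in_itv/= lexx ler01.
exists (F @` (c @` `[0, 1]%classic)); last by exists (V * P * V').
split; first by exists P.
  move=> _ [_ [r r01 <-] <-]; have {}r01 : 0 <= r <= 1 by move: r01; rewrite /= in_itv.
  by have [pr Pr] := cP _ r01; exact: AF pr Pr AP.
apply: connected_continuous_connected; first exact: connected_path cC.
exact: continuous_subspaceT.
Qed.

Lemma intertwined_component P Q : projections P -> intertwined P Q -> A (F P) ->
  connected_component A (F P) (F Q).
Proof.
move=> pP [U [U' [Uu UP]]] AP.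
have [V1 [V1' [V2 [V2' [V1u V2u V1pos V2pos UV]]]]] := unitary_factor Uu.
have [p2 P2] := conjugate_projection V2u pP.
have A2 := AF p2 P2 AP.
apply: connected_component_trans (accretive_component V2u V2pos pP AP) _.
(* Conjugating by V2 and then by V1 is conjugating by U, which turns P into Q because U P = Q U. *)
have <- : V1 * (V2 * P * V2') * V1' = Q; last exact: accretive_component.
have [W1 _ _] := unitary_pairM V1u V2u.
by rewrite -[RHS]mulr1 -W1 -UV !mulrA -UP UV.
Qed.

End SlotDeformation.

Lemma intertwined_Cklmn k l m n p q : proj_pairs q ->
  intertwined p.1 q.1 -> intertwined p.2 q.2 -> Cklmn H k l m n p -> Cklmn H k l m n q.
Proof.
move=> pq i1 i2 [_ [pk pl pm pn]]; split=> //.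
have h1 := intertwined_hdim _ i1; have h2 := intertwined_hdim _ i2.
by split; [apply: (h1 k).1|apply: (h1 l).2|apply: (h2 m).1|apply: (h2 n).2].
Qed.

Lemma intertwined_refl P : intertwined P P.
Proof.
exists 1, 1; split; last by rewrite mulr1 mul1r.
by split; [rewrite mulr1|rewrite mulr1|exact: adjoint1].
Qed.

Lemma Cklmn_component k l m n p q : Cklmn H k l m n p -> Cklmn H k l m n q ->
  connected_component (Cklmn H k l m n) p q.
Proof.
case: p q => [P Q] [P' Q'] Cp Cq.
have [[/= pP pQ] [/= Pk Pl Qm Qn]] := Cp; have [[/= pP' pQ'] [/= P'k P'l Q'm Q'n]] := Cq.
have PP' : intertwined P P' := intertwined_of_hdim pP pP' Pk Pl P'k P'l.
have QQ' : intertwined Q Q' := intertwined_of_hdim pQ pQ' Qm Qn Q'm Q'n.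
(* The corner (P', Q) at which the deformation of the first slot hands over to that of the
   second. *)
have C' : Cklmn H k l m n (P', Q) by split.
apply: (connected_component_trans (y := (P', Q))).
  apply: (@intertwined_component (fun T => (T, Q))) => //.
    move=> x; have xQ := @cvg_pair _ _ _ (nbhs x) (nbhs x) (nbhs Q) _ _ _ idfun (fun=> Q).
    exact: (xQ _ _ _ cvg_id (@cvg_cst _ Q _ _ _)).
  by move=> T T' pT' TT' CT; apply: intertwined_Cklmn CT => //; exact: intertwined_refl.
apply: (@intertwined_component (fun T => (P', T))) => //.
  move=> x; have Px := @cvg_pair _ _ _ (nbhs x) (nbhs P') (nbhs x) _ _ _ (fun=> P') idfun.
  exact: (Px _ _ _ (@cvg_cst _ P' _ _ _) cvg_id).
by move=> T T' pT' TT' CT; apply: intertwined_Cklmn CT => //; exact: intertwined_refl.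
Qed.

(** The radius is the threshold of [near_intertwined], and the interior supplies an open set. *)
Definition near_pairs p := interior (ball p (2^-1)%:C).

Lemma near_pairs_self p : near_pairs p p.
Proof. by apply: nbhsx_ballx; rewrite ltcR invr_gt0. Qed.

Lemma near_Cklmn k l m n p q : proj_pairs p -> proj_pairs q -> near_pairs p q ->
  (Cklmn H k l m n p <-> Cklmn H k l m n q).
Proof.
move=> pp pq /interior_subset[]; rewrite -!ball_normE/= !normE !ltcR !rnorm_bop => d1 d2.
case: (pp) => pp1 pp2; case: (pq) => pq1 pq2.
have i1 : intertwined p.1 q.1 by apply: near_intertwined => //; lra.
have i2 : intertwined p.2 q.2 by apply: near_intertwined => //; lra.
by split; apply: intertwined_Cklmn => //; exact: intertwined_sym.
Qed.

(** The intersection [D] is clopen in [B]: by [near_Cklmn] the neighbourhoods of points of [D] meet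
    [B] only in [D], and those of the other points of [B] avoid [D]. *)
Lemma connected_sub_Cklmn (B : set (bop H * bop H)) k l m n p :
  connected B -> B `<=` @proj_pairs R H -> B p -> Cklmn H k l m n p -> B `<=` Cklmn H k l m n.
Proof.
move=> Bconn Bproj Bp Cp; pose D := B `&` Cklmn H k l m n.
pose O (S : set (bop H * bop H)) := \bigcup_(p in S) near_pairs p.
have Oopen S : open (O S) by apply: bigcup_open => i _; exact: open_interior.
suff <- : D = B by move=> x [].
apply: Bconn; first by exists p.
- exists (O D); first exact: Oopen.
  apply/seteqP; split=> x [Bx] h; split=> //; first by exists x => //; exact: near_pairs_self.
  by have [y [By Cy] /near_Cklmn yx] := h; apply/yx => //; exact: Bproj.
- exists (~` O (B `\` Cklmn H k l m n)); first exact: open_closedC.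
  apply/seteqP; split=> x [Bx] h; split=> //.
    move=> [y [By Cy] /near_Cklmn yx]; apply: Cy; apply/yx => //; exact: Bproj.
  by apply: contrapT => Cx; apply: h; exists x => //; exact: near_pairs_self.
Qed.

Lemma component_Cklmn k l m n p : Cklmn H k l m n `<=` C0 H -> Cklmn H k l m n p ->
  connected_component (C0 H) p = Cklmn H k l m n.
Proof.
move=> CC0 Cp; apply/seteqP; split=> q.
  move=> [B [Bp BC0 Bconn] Bq]; apply: connected_sub_Cklmn Bconn _ Bp Cp q Bq.
  by move=> x /BC0[].
move=> Cq; have [B [Bp BC Bconn] Bq] := Cklmn_component Cp Cq.
by exists B => //; split=> // x /BC /CC0.
Qed.

(** The basis itself, as a type, serves as its cardinal. *)
Lemma hdim_exists (L : set H) : subspace L -> closed L -> exists k : Type, hdim L k.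
Proof.
move=> sL cL; have [E EL] := orthonormal_basis_exists sL cL.
by exists (set_type E), E => //; rewrite card_eq_sym; exact: card_setT.
Qed.

Lemma has_rank_exists P : projections P -> exists k : Type, has_rank P k.
Proof.
move=> pP; rewrite /has_rank (range_proj pP).
by apply: hdim_exists; [exact: nullspace_subspace|exact: nullspace_closed].
Qed.

Lemma has_nullity_exists P : exists k : Type, has_nullity P k.
Proof. by apply: hdim_exists; [exact: nullspace_subspace|exact: nullspace_closed]. Qed.

End Components.

(** A finite nullity alone does not place a pair in [C0 H]: for H of infinite dimension, (1, 1) has
    nullities 0 and infinite ranks. The inclusion in [C0 H] excludes such classes, and nonemptiness
    excludes the quadruples that no pair realises. *)
Theorem mainTheorem1 (R : realType) (H : hilbertType R) :
  connected_components (C0 H) =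
  [set C | exists k l m n : Type,
     [/\ C = Cklmn H k l m n, min_finite k l m n, C !=set0 & C `<=` C0 H]].
Proof.
apply/seteqP; split=> [_ [[P Q] C0p <-]|C [k [l [m [n [-> _ [p Cp] CC0]]]]]]; last first.
  by exists p; [exact: CC0|exact: component_Cklmn].
have [[/= pP pQ] [[a Pa]|[a Qa]]] := C0p.
- have [l Pl] := has_nullity_exists P; have [m Qm] := has_rank_exists pQ.
  have [n Qn] := has_nullity_exists Q.
  (* Naming the finite rank by ['I_a] puts the whole class in [C0 H], since each of its members has
     that rank. *)
  have CC0 : Cklmn H 'I_a l m n `<=` C0 H.
    by move=> q [pq [qa _ _ _]]; split=> //; left; exists a.
  have Cp : Cklmn H 'I_a l m n (P, Q) by split.
  exists 'I_a, l, m, n; rewrite (component_Cklmn CC0 Cp); split=> //; last by exists (P, Q).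
  by constructor 1; exact: finite_finset.
- have [l Pl] := has_nullity_exists P; have [k Pk] := has_rank_exists pP.
  have [n Qn] := has_nullity_exists Q.
  have CC0 : Cklmn H k l 'I_a n `<=` C0 H.
    by move=> q [pq [_ _ qa _]]; split=> //; right; exists a.
  have Cp : Cklmn H k l 'I_a n (P, Q) by split.
  exists k, l, 'I_a, n; rewrite (component_Cklmn CC0 Cp); split=> //; last by exists (P, Q).
  by constructor 3; exact: finite_finset.
Qed.
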